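(* For every $\varepsilon>0$ there exists a Banach space $X$ with the CPCP such that every slice of the unit ball $B_X$ has diameter at least $2-\varepsilon$.
   Context: All Banach spaces are real. $B_X$ is the closed unit ball of $X$. A slice of $B_X$ is a set $\{x\in B_X:x^*(x)>1-\alpha\}$ with $x^*\in S_{X^*}$ (the unit sphere of $X^*$) and $\alpha>0$. $X$ has the convex point of continuity property (CPCP) if every non-empty, bounded, closed and convex subset of $B_X$ contains non-empty relatively weakly open subsets of arbitrarily small diameter. *)

(* Defs.v *)
From HB Require Import structures.
From mathcomp Require Import all_boot all_order all_algebra.
From mathcomp Require Import all_classical all_reals all_analysis.

Set Implicit Arguments.
Unset Strict Implicit.
Unset Printing Implicit Defensive.

Import Order.TTheory GRing.Theory Num.Theory.
Import numFieldNormedType.Exports.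

Local Open Scope classical_set_scope.
Local Open Scope ring_scope.

Definition closed_unit_ball (R : realType) (X : normedModType R) : set X :=
  [set x | `|x| <= 1].
Arguments closed_unit_ball {R} X.

(* Values in \bar R, so that no junk value arises for unbounded sets;
   diameter set0 = -oo. *)
Definition diameter (R : realType) (X : normedModType R) (A : set X) : \bar R :=
  ereal_sup [set (`|p.1 - p.2|)%:E | p in A `*` A].

(* Elements of the topological dual X^*. *)
Definition dual (R : realType) (X : normedModType R) : Type :=
  {f : {linear X -> R^o} | continuous f}.

Definition dual_fun (R : realType) (X : normedModType R) (f : dual X) :
  X -> R^o := sval f.
Coercion dual_fun : dual >-> Funclass.

Definition dual_norm (R : realType) (X : normedModType R) (f : dual X) :
    \bar R :=
  ereal_sup [set (`|f x|)%:E | x in closed_unit_ball X].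

Definition dual_unit_sphere (R : realType) (X : normedModType R) :
    set (dual X) :=
  [set f | dual_norm f = 1%:E].
Arguments dual_unit_sphere {R} X.

Definition slice (R : realType) (X : normedModType R) (f : dual X) (alpha : R) :
    set X :=
  closed_unit_ball X `&` [set x | f x > 1 - alpha].

(* The initial topology of the family of all f in X^*, as the supremum of the
   initial topologies of the individual functionals. *)
Definition weak_space (R : realType) (X : normedModType R) : topologicalType :=
  sup_topology (fun f : dual X =>
    Topological.on (initial_topology (f : X -> R^o))).

Definition weakly_open (R : realType) (X : normedModType R) (U : set X) : Prop :=
  @open (weak_space X) U.

Definition relatively_weakly_open (R : realType) (X : normedModType R)
    (C V : set X) : Prop :=
  exists2 U : set X, weakly_open U & V = C `&` U.

(* Convex point of continuity property. *)
Definition CPCP (R : realType) (X : normedModType R) : Prop :=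
  forall C : set X,
    C `<=` closed_unit_ball X -> C !=set0 ->
    bounded_set C -> closed C -> convex_set (C : set (convex_lmodType X)) ->
    forall eta : R, 0 < eta ->
      exists V : set X,
        [/\ relatively_weakly_open C V, V !=set0 & (diameter V < eta%:E)%E].
Arguments CPCP {R} X.

(* Main.v *)
(* X is the completion of the simple functions on the Cantor set {0,1}^N, viewed
   as additive functions x on the nodes t of the binary tree (x t = mass of the
   cylinder of t), under the norm dual to a tree p-variation of martingales G:
   the supremum of sum_i (G(t_i) - G(s_i))^p over edge-disjoint segments
   [s_i, t_i] of branches, for a large even p.

   Slices: a martingale can always be followed upwards or downwards, so optimal
   families of segments may be taken to end at all the leaves of some level.  A
   functional of norm 1 is almost attained at an atom
   sum_i c_i (h_{t_i} - h_{s_i}), h_t being the normalized indicator of the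
   cylinder of t.  Replacing every t_i by its left, resp. right, child gives two
   points of the ball whose midpoint is the atom, hence both in the slice, and
   at distance close to 2 / 2^(1/p).

   CPCP (in fact the point of continuity property): if all weak neighbourhoods
   in C were large, one could build points of C converging on the nodes to a
   bounded additive z which is uniformly small on infinitely many levels but
   whose tails never become small.  Such a z does not exist.  Either the tails
   concentrate along a branch; then tests living in successive blocks of that
   branch, each forced to return to 0 at a node where z is tiny, add up to
   contradict boundedness.  Or they disperse; then two almost optimal tests on
   far apart levels hardly interact, and their sum beats the optimal tail. *)

Require Import Defs.
From HB Require Import structures.
From mathcomp Require Import all_boot all_order all_algebra.
From mathcomp Require Import all_classical all_reals all_analysis.
From mathcomp Require Import ring lra zify.

Set Implicit Arguments.
Unset Strict Implicit.
Unset Printing Implicit Defensive.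

Import Order.TTheory GRing.Theory Num.Theory.
Import numFieldNormedType.Exports.

Local Open Scope classical_set_scope.
Local Open Scope ring_scope.

(** * Even powers x^p, p = 2(k+1): Young and Bernoulli type inequalities *)

Section EvenPower.
Variables (R : realType) (k : nat).
Implicit Types x y : R.

Definition epow (x : R) : R := x ^+ (k.+1).*2.

Lemma epow_ge0 x : 0 <= epow x.
Proof. by rewrite /epow -mul2n exprM exprn_ge0 // sqr_ge0. Qed.

Lemma epow0 : epow 0 = 0.
Proof. by rewrite /epow expr0n. Qed.

Lemma epow1 : epow 1 = 1.
Proof. by rewrite /epow expr1n. Qed.

Lemma epowM x y : epow (x * y) = epow x * epow y.
Proof. by rewrite /epow exprMn. Qed.

Lemma epow_norm x : epow `|x| = epow x.
Proof. by rewrite /epow -mul2n !exprM real_normK // num_real. Qed.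

Lemma epowN x : epow (- x) = epow x.
Proof. by rewrite -epow_norm normrN epow_norm. Qed.

Lemma ler_epow x y : `|x| <= `|y| -> epow x <= epow y.
Proof.
move=> xy; rewrite -(epow_norm x) -(epow_norm y) /epow.
by rewrite lerXn2r // nnegrE.
Qed.

Lemma epow_le1 x : (epow x <= 1) = (`|x| <= 1).
Proof.
by rewrite -(epow_norm x) /epow expr_le1. Qed.

Lemma epow_eq0 x : (epow x == 0) = (x == 0).
Proof. by rewrite /epow expf_eq0. Qed.

Lemma epow_superadd x y : 0 <= x -> 0 <= y -> epow x + epow y <= epow (x + y).
Proof.
move=> x0 y0; rewrite /epow.
have -> : (k.+1).*2 = (k.*2.+1).+1 by rewrite doubleS.
rewrite !(exprSr _ (k.*2.+1)) mulrDr.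
by apply: lerD; apply: ler_wpM2r => //; rewrite lerXn2r ?nnegrE ?addr_ge0 // ?lerDl ?lerDr.
Qed.

Lemma epowD_le x y : epow (x + y) <= epow 2 * (epow x + epow y).
Proof.
wlog xy : x y / `|x| <= `|y|.
  move=> H; case: (lerP `|x| `|y|) => [|/ltW] /H //.
  by rewrite addrC (addrC (epow x)).
apply: (@le_trans _ _ (epow 2 * epow y)).
  rewrite -epowM; apply: ler_epow; rewrite normrM [`|2|]ger0_norm //.
  by apply: le_trans (ler_normD _ _) _; lra.
by apply: ler_wpM2l; rewrite ?epow_ge0 // lerDr epow_ge0.
Qed.

Lemma epow_le_id x : 0 <= x -> x <= 1 -> epow x <= x.
Proof.
move=> x0 x1; rewrite /epow doubleS exprS -[leRHS]mulr1.
by rewrite ler_wpM2l // exprn_ile1.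
Qed.

Lemma epow_ge_sqr x : 1 <= `|x| -> x ^+ 2 <= epow x.
Proof.
move=> x1; rewrite -(epow_norm x) -(real_normK (num_real x)) /epow.
by apply: ler_weXn2l => //; rewrite doubleS.
Qed.

Lemma epow_le_sqr x : `|x| <= 1 -> epow x <= x ^+ 2.
Proof.
move=> x1; rewrite -(epow_norm x) -(real_normK (num_real x)) /epow.
by apply: ler_wiXn2l => //; rewrite doubleS.
Qed.

(** Induction: the inductive inequality times [y], plus (n+1) x^n (x - y)^2 >= 0, gives the next
    one. *)
Lemma young_nonneg n x y : 0 <= x -> 0 <= y ->
  n.+1%:R * (x ^+ n * y) <= n%:R * x ^+ n.+1 + y ^+ n.+1.
Proof.
move=> x0 y0; elim: n => [|n IHn]; first by rewrite !mul1r mul0r add0r expr1.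
have := ler_wpM2r y0 IHn.
have : 0 <= n.+1%:R * (x ^+ n * (x - y) ^+ 2).
  by rewrite mulr_ge0 ?ler0n // mulr_ge0 ?sqr_ge0 ?exprn_ge0.
rewrite !exprS expr0 mulr1.
have -> : n.+2%:R = n%:R + 2 :> R by rewrite -addn2 natrD.
have -> : n.+1%:R = n%:R + 1 :> R by rewrite -addn1 natrD.
move: (x ^+ n) (y ^+ n) (n%:R : R) => X Y N h1 h2.
lra.
Qed.

(* The signed power x^(p-1) for p = 2(k+1). *)
Definition epow_deriv x : R := x ^+ (k.*2.+1).

Lemma epow_deriv_mul x : epow_deriv x * x = epow x.
Proof. by rewrite /epow_deriv /epow -exprSr doubleS. Qed.

Lemma young x y : (k.+1).*2%:R * (epow_deriv x * y) <=
  (k.*2.+1)%:R * epow x + epow y.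
Proof.
have := young_nonneg (k.*2.+1) (normr_ge0 x) (normr_ge0 y).
rewrite -doubleS -!/(epow _) !epow_norm; apply: le_trans.
apply: ler_wpM2l => //; rewrite /epow_deriv -normrX -normrM; exact: ler_norm.
Qed.

(** (1 + a)^n <= 1 + 2na as long as 2na <= 1. In the dispersed case this caps the gain of a
    prolonged segment by the factor 5/4. *)
Lemma epow_near1 : epow (1 + (8 * (k.+1).*2%:R)^-1) <= 1 + 4^-1.
Proof.
have H (a : R) n : 0 <= a -> 2 * n%:R * a <= 1 ->
    (1 + a) ^+ n <= 1 + 2 * n%:R * a.
  move=> a0; elim: n => [|n IHn] h; first by rewrite expr0; lra.
  have n0 : (0 : R) <= n%:R by rewrite ler0n.
  have e : n.+1%:R = n%:R + 1 :> R by rewrite -addn1 natrD.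
  have na0 : 0 <= n%:R * a by rewrite mulr_ge0.
  move: h; rewrite e => h.
  have {}IHn := IHn ltac:(lra).
  have a1 : 0 <= 1 + a by lra.
  have := ler_wpM2l a1 IHn; rewrite exprS => /le_trans; apply.
  have : (2 * n%:R * a) * a <= 1 * a by apply: ler_wpM2r => //; lra.
  lra.
have p0 : (0 : R) < (k.+1).*2%:R by rewrite ltr0n.
set N := (k.+1).*2%:R in p0 *.
have e : 2 * N * (8 * N)^-1 = 4^-1 by field; rewrite gt_eqF.
have := H ((8 * N)^-1) (k.+1).*2; rewrite -/N e; apply.
  by rewrite invr_ge0; lra.
lra.
Qed.

End EvenPower.

(** * Martingales on the binary tree and their p-variation *)

Section TreeFunctions.
Variables (R : realType) (k : nat).
Implicit Types (G H F x y : seq bool -> R) (t s : seq bool) (b : bool).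

Definition child b G : seq bool -> R := fun t => G (b :: t).

Definition below s G : seq bool -> R := fun t => G (s ++ t).

Definition martingale G :=
  forall t, G t = (G (rcons t false) + G (rcons t true)) / 2.

Definition additive x := forall t, x t = x (rcons t false) + x (rcons t true).

Definition trunc n G : seq bool -> R := fun t => G (take n t).

Definition tail n G : seq bool -> R := fun t => G t - G (take n t).

(* The tree p-variation over the first n levels.  Here u is the value at the
   start of the segment arriving at the root: it continues into one child, a new
   segment enters the other child, and all segments end at level n. *)
Fixpoint pvar n G (u : R) : R :=
  if n is m.+1 then
    Num.max (pvar m (child false G) u + pvar m (child true G) (G [::]))
            (pvar m (child true G) u + pvar m (child false G) (G [::]))
  else epow k (G [::] - u).

Fixpoint pairing n x G : R :=
  if n is m.+1 then
    pairing m (child false x) (child false G) +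
    pairing m (child true x) (child true G)
  else x [::] * G [::].

Fixpoint graft s H : seq bool -> R :=
  if s is b :: s' then
    fun t => if t is c :: t' then if c == b then graft s' H t' else 0 else 0
  else H.

Lemma martingale_child b G : martingale G -> martingale (child b G).
Proof. by move=> mG t; rewrite /child mG. Qed.

Lemma additive_child b x : additive x -> additive (child b x).
Proof. by move=> ax t; rewrite /child ax. Qed.

Lemma additive_below s x : additive x -> additive (below s x).
Proof. by move=> ax t; rewrite /below ax !rcons_cat. Qed.

Lemma martingale0 : martingale (fun=> 0).
Proof. by move=> t; rewrite addr0 mul0r. Qed.

Lemma martingaleD F G : martingale F -> martingale G -> martingale (F + G).
Proof. by move=> mF mG t; rewrite !fctE mF mG; lra. Qed.

Lemma martingaleZ (a : R) G : martingale G -> martingale (fun t => a * G t).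
Proof. by move=> mG t; rewrite mG; lra. Qed.

Lemma martingale_root b G : martingale G ->
  G [::] = (G [:: b] + G [:: ~~ b]) / 2.
Proof. by move=> /(_ [::]) /= ->; case: b; rewrite // addrC. Qed.

Lemma martingale_trunc n G : martingale G -> martingale (trunc n G).
Proof.
move=> mG t; rewrite /trunc; case: (ltnP (size t) n) => h.
  by rewrite take_oversize ?(ltnW h) // !take_oversize ?size_rcons.
have e b : take n (rcons t b) = take n t.
  by rewrite -cats1 takel_cat.
by rewrite !e; lra.
Qed.

Lemma martingale_tail n G : martingale G -> martingale (tail n G).
Proof.
by move=> mG t; rewrite /tail mG; have := martingale_trunc n mG t; rewrite /trunc => ->; lra.
Qed.

Lemma martingale_graft s H : martingale H -> H [::] = 0 ->
  martingale (graft s H) /\ graft s H [::] = 0.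
Proof.
move=> mH H0; elim: s => [|b s [IHm IH0]]; first by split.
split=> // -[|c t] /=; last by case: ifP => _; rewrite ?addr0 ?mul0r // IHm.
by case: b; rewrite /= IH0 addr0 mul0r.
Qed.

Lemma child_graft b s H : child b (graft (b :: s) H) = graft s H.
Proof. by apply/funext => t; rewrite /child /= eqxx. Qed.

Lemma childN_graft b s H : child (~~ b) (graft (b :: s) H) = fun=> 0.
Proof. by apply/funext => t; rewrite /child /=; case: b. Qed.

Lemma pvarS_ge b n G u :
  pvar n (child b G) u + pvar n (child (~~ b) G) (G [::]) <= pvar n.+1 G u.
Proof. by case: b; rewrite /= le_max lexx ?orbT. Qed.

Lemma pvarS_ex n G u : exists b,
  pvar n.+1 G u = pvar n (child b G) u + pvar n (child (~~ b) G) (G [::]).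
Proof. by rewrite /=; case: leP => _; [exists true | exists false]. Qed.

Lemma pvarS_le n G u c :
  (forall b, pvar n (child b G) u + pvar n (child (~~ b) G) (G [::]) <= c) ->
  pvar n.+1 G u <= c.
Proof. by move=> h; have [b ->] := pvarS_ex n G u. Qed.

Lemma pvar_ge0 n G u : 0 <= pvar n G u.
Proof.
elim: n G u => [|n IHn] G u; first exact: epow_ge0.
by apply: le_trans (pvarS_ge true n G u); rewrite addr_ge0.
Qed.

Lemma pvar_translate n G u c : pvar n (fun t => G t - c) (u - c) = pvar n G u.
Proof.
elim: n G u => [|n IHn] G u /=; first by congr epow; lra.
by congr Num.max; congr +%R; exact: IHn.
Qed.

Lemma pvarZ n G u c : pvar n (fun t => c * G t) (c * u) = epow k c * pvar n G u.
Proof.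
elim: n G u => [|n IHn] G u /=; first by rewrite -mulrBr epowM.
by rewrite maxr_pMr ?epow_ge0 // !mulrDr -!IHn.
Qed.

Lemma pvarZ0 n G c : pvar n (fun t => c * G t) 0 = epow k c * pvar n G 0.
Proof. by rewrite -pvarZ mulr0. Qed.

Lemma pvar_eq n F G u : (forall t, (size t <= n)%N -> F t = G t) ->
  pvar n F u = pvar n G u.
Proof.
elim: n F G u => [|n IHn] F G u h /=; first by rewrite h.
by rewrite h //; congr Num.max; congr +%R; apply: IHn => t ht; apply: h.
Qed.

Lemma pvar_const n (c u : R) : pvar n (fun=> c) u = epow k (c - u).
Proof.
elim: n u => [|n IHn] u //=.
by rewrite !IHn subrr epow0 addr0 maxxx.
Qed.

Lemma epow_superadd_sign (a c : R) : 0 <= a * c ->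
  epow k a + epow k c <= epow k (a + c).
Proof.
move=> ac.
have neg (u v : R) : u <= 0 -> v <= 0 -> epow k u + epow k v <= epow k (u + v).
  move=> u0 v0; rewrite -(epowN k u) -(epowN k v) -(epowN k (u + v)) opprD.
  by apply: epow_superadd; lra.
case: (ltrP a 0) => a0.
  by apply: neg; [exact: ltW | rewrite nmulr_rge0 in ac].
case: (ltrP c 0) => c0.
  by apply: neg; [rewrite nmulr_lge0 in ac | exact: ltW].
exact: epow_superadd.
Qed.

(** The case of [pvar_push] in which the child value [v] falls on the wrong side of [c]: since [g]
    is the mean of the children, the sibling [v'] lies beyond [g], and the open segment can be sent
    there instead. *)
Lemma push_signs (u c g v v' : R) : g = (v + v') / 2 ->
  0 <= (c - u) * (g - c) -> (c - u) * (v - c) < 0 ->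
  [/\ 0 <= (g - u) * (v' - g), 0 <= (c - g) * (v - c) & `|c - u| <= `|g - u|].
Proof.
move=> e; case: (ltrgtP u c) => uc.
- have cu : 0 < c - u by lra.
  rewrite pmulr_rge0 // pmulr_rlt0 // => h1 h2.
  split; [apply: mulr_ge0; lra | apply: mulr_le0; lra |].
  by rewrite !ger0_norm; lra.
- have cu : c - u < 0 by lra.
  rewrite nmulr_rge0 // nmulr_rlt0 // => h1 h2.
  split; [apply: mulr_le0; lra | apply: mulr_ge0; lra |].
  by rewrite !ler0_norm; lra.
- by rewrite uc subrr !mul0r ltxx.
Qed.

(* Cutting the open segment at a value c between its start and G [::] does not
   increase the sum: the martingale can always be followed in the direction
   in which it moves away from the start. *)
Lemma pvar_push m G u c : martingale G -> 0 <= (c - u) * (G [::] - c) ->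
  epow k (c - u) + pvar m G c <= pvar m G u.
Proof.
elim: m G u c => [|m IHm] G u c mG h.
  have := epow_superadd_sign h.
  by rewrite (_ : (c - u) + (G [::] - c) = G [::] - u) //; lra.
have [b eb] := pvarS_ex m G c.
have mb := martingale_child b mG; have mb' := martingale_child (~~ b) mG.
have root := martingale_root b mG.
case: (lerP 0 ((c - u) * (child b G [::] - c))) => hb.
  apply: le_trans (pvarS_ge b m G u); rewrite eb.
  by have := IHm _ _ _ mb hb; lra.
apply: le_trans (pvarS_ge (~~ b) m G u); rewrite eb negbK.
have [h1 h2 h3] := push_signs root h hb.
have := IHm _ _ _ mb' h1; have := IHm _ _ _ mb h2.
by have := ler_epow k h3; have := epow_ge0 k (c - G [::]); lra.
Qed.

Lemma pvar_root m G u : martingale G ->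
  epow k (G [::] - u) + pvar m G (G [::]) <= pvar m G u.
Proof. by move=> mG; apply: pvar_push => //; rewrite subrr mulr0. Qed.

Lemma pvar_le_start m G u : martingale G -> pvar m G (G [::]) <= pvar m G u.
Proof.
by move=> mG; apply: le_trans (pvar_root m u mG); rewrite lerDr epow_ge0.
Qed.

Lemma pvar_leS n G u : martingale G -> pvar n G u <= pvar n.+1 G u.
Proof.
elim: n G u => [|n IHn] G u mG.
  by apply: le_trans (pvar_root 1 u mG); rewrite lerDl pvar_ge0.
have [b ->] := pvarS_ex n G u; apply: le_trans (pvarS_ge b _ _ _).
by apply: lerD; apply: IHn; exact: martingale_child.
Qed.

Lemma pvar_mono m n G u : martingale G -> (m <= n)%N -> pvar m G u <= pvar n G u.
Proof.
move=> mG /subnKC <-; elim: (n - m)%N => [|d IHd]; first by rewrite addn0.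
by rewrite addnS; apply: le_trans IHd (pvar_leS _ _ mG).
Qed.

Lemma pvar_node n G u t : martingale G -> (size t <= n)%N ->
  epow k (G t - u) <= pvar n G u.
Proof.
elim: t n G u => [|b t IHt] n G u mG.
  by move=> _; apply: le_trans (pvar_root n u mG); rewrite lerDl pvar_ge0.
case: n => // n tn; apply: le_trans (pvarS_ge b n G u).
apply: ler_wpDr; first exact: pvar_ge0.
by apply: (IHt n (child b G)) => //; exact: martingale_child.
Qed.

(** Down to level [n] the tail is 0 and its segments cost nothing; at each node of level [n] they
    restart from the value of [G] there, the cheapest start by [pvar_le_start]. *)
Lemma pvar_tail n m G u : martingale G -> pvar m (tail n G) 0 <= pvar m G u.
Proof.
elim: n m G u => [|n IHn] m G u mG.
  apply: le_trans (pvar_le_start _ _ mG).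
  rewrite -(pvar_translate m G _ (G [::])) subrr.
  by rewrite /tail (_ : (fun t => _) = fun t => G t - G [::]) //;
    apply/funext => t; rewrite take0.
case: m => [|m].
  by rewrite /= /tail /= subrr subrr epow0 epow_ge0.
apply: pvarS_le => b; apply: le_trans (pvarS_ge b m G u).
rewrite /= {3}/tail /= subrr.
by apply: lerD; apply: IHn; exact: martingale_child.
Qed.

Lemma pvar_trunc n m G u : martingale G -> pvar m (trunc n G) u <= pvar n G u.
Proof.
elim: n m G u => [|n IHn] m G u mG.
  rewrite /= -(pvar_const m (G [::])) /trunc.
  by rewrite (_ : (fun t => _) = fun=> G [::]) //; apply/funext => t; rewrite take0.
case: m => [|m]; first by rewrite /= -/(pvar n.+1 G u); exact: (@pvar_node n.+1 G u [::]).
apply: pvarS_le => b; apply: le_trans (pvarS_ge b n G u).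
by apply: lerD; apply: IHn; exact: martingale_child.
Qed.

(** A family of segments that is optimal for the sum is admissible for each summand. *)
Lemma pvarD n F G u v :
  pvar n (F + G) (u + v) <= epow k 2 * (pvar n F u + pvar n G v).
Proof.
elim: n F G u v => [|n IHn] F G u v.
  have := epowD_le k (F [::] - u) (G [::] - v).
  by rewrite (_ : _ - u + _ = (F + G) [::] - (u + v)) // fctE; lra.
apply: pvarS_le => b.
have := IHn (child b F) (child b G) u v.
have := IHn (child (~~ b) F) (child (~~ b) G) (F [::]) (G [::]).
move=> h1 h2; apply: (le_trans (lerD h2 h1)); rewrite -mulrDr.
apply: ler_wpM2l; first exact: epow_ge0.
by have := pvarS_ge b n F u; have := pvarS_ge b n G v; lra.
Qed.

Lemma pvarS0 n G : G [::] = 0 ->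
  pvar n.+1 G 0 = pvar n (child false G) 0 + pvar n (child true G) 0.
Proof. by move=> G0; rewrite /= G0 addrC maxxx. Qed.

(** The start value enters only the one segment that is open at the root; all others contribute the
    same for both starts. *)
Lemma pvar_shift n G u X : (forall t, `|G t| <= X) ->
  pvar n G u <= pvar n G 0 + epow k (X + `|u|).
Proof.
elim: n G => [|n IHn] G GX.
  rewrite /= subr0; apply: ler_wpDl; first exact: epow_ge0.
  apply: ler_epow; rewrite [leRHS]ger0_norm; last first.
    by apply: addr_ge0 => //; apply: le_trans (GX [::]).
  by apply: le_trans (ler_normB _ _) _; rewrite lerD2r.
apply: pvarS_le => b; have := pvarS_ge b n G 0.
by have := IHn (child b G) (fun t => GX (b :: t)); lra.
Qed.

End TreeFunctions.

(** * Pairing of additive functions with martingales; unit tests and tails *)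

Section Pairing.
Variables (R : realType) (k : nat).
Implicit Types (G H F x y z : seq bool -> R) (t s : seq bool) (b : bool).

Lemma pairingDl n x y G : pairing n (x + y) G = pairing n x G + pairing n y G.
Proof.
elim: n x y G => [|n IHn] x y G /=; first by rewrite !fctE mulrDl.
by rewrite addrACA -!IHn.
Qed.

Lemma pairingZl n a x G : pairing n (fun t => a * x t) G = a * pairing n x G.
Proof. by elim: n x G => [|n IHn] x G /=; rewrite ?mulrA // mulrDr -!IHn. Qed.

Lemma pairingDr n x F G : pairing n x (F + G) = pairing n x F + pairing n x G.
Proof.
elim: n x F G => [|n IHn] x F G /=; first by rewrite !fctE mulrDr.
by rewrite addrACA -!IHn.
Qed.

Lemma pairingZr n a x G : pairing n x (fun t => a * G t) = a * pairing n x G.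
Proof. by elim: n x G => [|n IHn] x G /=; rewrite ?mulrDr -?IHn // mulrCA. Qed.

Lemma pairing_eqr n x F G : (forall t, size t = n -> F t = G t) ->
  pairing n x F = pairing n x G.
Proof.
elim: n x F G => [|n IHn] x F G h /=; first by rewrite h.
by congr +%R; apply: IHn => t ht; apply: h; rewrite /= ht.
Qed.

Lemma pairing_0r n x G : (forall t, size t = n -> G t = 0) -> pairing n x G = 0.
Proof.
move=> h; rewrite (@pairing_eqr n x G (fun t => 0 * G t)) ?pairingZr ?mul0r //.
by move=> t /h ->; rewrite mul0r.
Qed.

Lemma pairing_const n x (c : R) : additive x ->
  pairing n x (fun=> c) = c * x [::].
Proof.
elim: n x => [|n IHn] x ax /=; first by rewrite mulrC.
by rewrite !IHn ?(ax [::]) ?mulrDr //; exact: additive_child.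
Qed.

Lemma pairing_trunc n m x G : additive x -> (n <= m)%N ->
  pairing m x (trunc n G) = pairing n x G.
Proof.
elim: n m x G => [|n IHn] [|m] x G ax //= nm.
- rewrite {1}/child /trunc /child /=.
  rewrite !pairing_const; try exact: additive_child.
  by rewrite (ax [::]) -mulrDr mulrC.
- by congr +%R; apply: IHn => //; exact: additive_child.
Qed.

Lemma pairing_tail n m x G : additive x -> (n <= m)%N ->
  pairing m x (tail n G) = pairing m x G - pairing n x G.
Proof.
move=> ax nm; rewrite -(pairing_trunc G ax nm) -[in RHS]mulN1r -pairingZr -pairingDr.
by congr pairing; apply/funext => t; rewrite fctE mulN1r.
Qed.

Lemma pairing_graft s n x H :
  pairing (size s + n) x (graft s H) = pairing n (below s x) H.
Proof.
elim: s n x => [|b s IHs] n x //.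
have e c : c != b -> child c (graft (b :: s) H) = fun=> 0.
  by move=> cb; rewrite (_ : c = ~~ b) ?childN_graft //; move: cb; case: b c => [] [].
rewrite /= ; case: b e => e.
  rewrite (e false) // -[X in _ + pairing _ _ X]/(child true (graft (true :: s) H)).
  by rewrite child_graft IHs pairing_0r // add0r.
rewrite (e true) // -[X in pairing _ _ X + _]/(child false (graft (false :: s) H)).
by rewrite child_graft IHs addrC pairing_0r // add0r.
Qed.

Lemma ler_pairing n x G (c : R) : (forall t, `|G t| <= 1) ->
  (forall t, size t = n -> `|x t| <= c) -> `|pairing n x G| <= 2 ^+ n * c.
Proof.
elim: n x G => [|n IHn] x G G1 xc /=.
  by rewrite normrM expr0 mul1r -[leRHS]mulr1 ler_pM ?xc.
apply: le_trans (ler_normD _ _) _; rewrite exprS -mulrA mulr_natl mulr2n.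
by apply: lerD; apply: IHn => t; rewrite ?/child //= => ht; apply: xc; rewrite /= ht.
Qed.

Lemma graftE s H t : (exists u, t = s ++ u /\ graft s H t = H u) \/ graft s H t = 0.
Proof.
elim: s t => [|b s IHs] [|c t] /=; try by [left; eexists; split|right].
case: eqP => [->|_]; last by right.
by have [[u [-> e]]|e] := IHs t; [left; exists u | right].
Qed.

Lemma graft_size s H t : H [::] = 0 -> (size t <= size s)%N -> graft s H t = 0.
Proof.
move=> H0 ts; have [[u [e ->]]|//] := graftE s H t.
by move: ts; rewrite e size_cat; case: u {e} => //= c u; lia.
Qed.

Lemma graft_cat s H t : graft s H (s ++ t) = H t.
Proof. by elim: s => [|b s IHs] //=; rewrite eqxx. Qed.

Lemma pvar_graft n s H : H [::] = 0 ->
  pvar k n (graft s H) 0 = if (size s <= n)%N then pvar k (n - size s) H 0 else 0.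
Proof.
move=> H0; elim: s n => [|b s IHs] n; first by rewrite subn0.
case: n => [|n]; first by rewrite /= subrr epow0.
rewrite pvarS0 ?graft_size //=; case: b.
  rewrite child_graft (childN_graft true) pvar_const subrr epow0 add0r IHs.
  by rewrite ltnS subSS.
rewrite child_graft (childN_graft false) pvar_const subrr epow0 addr0 IHs.
by rewrite ltnS subSS.
Qed.

Lemma pvar_graft_le n s H c : H [::] = 0 -> (forall m, pvar k m H 0 <= c) ->
  pvar k n (graft s H) 0 <= c.
Proof.
move=> H0 Hc; rewrite pvar_graft //; case: ifP => // _.
exact: le_trans (pvar_ge0 k 0 H 0) (Hc 0%N).
Qed.

(** The norming set of the space. The segment at the root starts from 0, so the root value counts
    too. *)
Definition unit_test G := martingale G /\ forall n, pvar k n G 0 <= 1.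

Lemma unit_test_le1 G t : unit_test G -> `|G t| <= 1.
Proof.
move=> [mG G1]; rewrite -(epow_le1 k).
by apply: le_trans (G1 (size t)); have := pvar_node k 0 mG (leqnn (size t)); rewrite subr0.
Qed.

Lemma unit_test_trunc n G : unit_test G -> unit_test (trunc n G).
Proof.
move=> [mG G1]; split=> [|m]; first exact: martingale_trunc.
by apply: le_trans (G1 n); exact: pvar_trunc.
Qed.

Lemma unit_test_tail n G : unit_test G -> unit_test (tail n G).
Proof.
move=> [mG G1]; split=> [|m]; first exact: martingale_tail.
by apply: le_trans (G1 m); exact: pvar_tail.
Qed.

Lemma unit_test_graft s G : G [::] = 0 -> unit_test G -> unit_test (graft s G).
Proof.
move=> G0 [mG G1]; split=> [|n]; last exact: pvar_graft_le.
by have [] := martingale_graft s mG G0.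
Qed.

Lemma unit_testN G : unit_test G -> unit_test (fun t => -1 * G t).
Proof.
move=> [mG G1]; split=> [|n]; first exact: martingaleZ.
by rewrite pvarZ0 epowN epow1 mul1r.
Qed.

Lemma unit_testZ G c : martingale G ->
  (forall n, epow k c * pvar k n G 0 <= 1) -> unit_test (fun t => c * G t).
Proof.
by move=> mG h; split=> [|n]; [exact: martingaleZ | rewrite pvarZ0].
Qed.

Definition vanishes n G := forall t, (size t <= n)%N -> G t = 0.

(** Its failure for every [c > 0] says that pairings with late tests tend to 0 uniformly. *)
Definition has_tail (c : R) z := forall n, exists G m,
  [/\ unit_test G, vanishes n G & c < pairing m z G].

Lemma has_tail_below c s z : has_tail c (below s z) -> has_tail c z.
Proof.
move=> h n; have [G [m [tG vG cG]]] := h n.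
have G0 : G [::] = 0 by exact: vG.
exists (graft s G), (size s + m)%N; split.
- exact: unit_test_graft.
- move=> t tn; have [[u [e ->]]|//] := graftE s G t.
  by apply: vG; move: tn; rewrite e size_cat; lia.
- by rewrite pairing_graft.
Qed.

Lemma has_tail_mono c d z : c <= d -> has_tail d z -> has_tail c z.
Proof.
move=> cd h n; have [G [m [tG vG dG]]] := h n.
by exists G, m; split => //; exact: le_lt_trans dG.
Qed.

(** Koenig's lemma: tails pass to ancestors by [has_tail_below]. [Q t] says that large tails occur
    at every depth below [t], and some child of [t] inherits it. *)
Lemma koenig_tail c z :
  (forall n, exists2 t, size t = n & has_tail c (below t z)) ->
  exists g : nat -> bool, forall n, has_tail c (below (mkseq g n) z).
Proof.
move=> h.
pose Q t := forall n, exists2 s, size s = n & has_tail c (below (t ++ s) z).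
have QS t : exists b, Q t -> Q (rcons t b).
  apply/not_existsP => Hn.
  have H b : Q t /\ ~ Q (rcons t b) by apply/not_implyP/Hn.
  have [Qt] := H false => /existsNP[n0 h0].
  have [_] := H true => /existsNP[n1 h1].
  (* If the children failed at depths [n0] and [n1], the ancestors of a witness at depth n0 + n1 + 1
     would refute the failure of the child it lies under. *)
  have [[|b s]] := Qt (n0 + n1).+1 => //= -[sn] hs.
  have A n : (n <= n0 + n1)%N ->
      exists2 s', size s' = n & has_tail c (below (rcons t b ++ s') z).
    move=> hn; exists (take n s); first by rewrite size_takel ?sn.
    apply: (@has_tail_below _ (drop n s)).
    rewrite (_ : below _ _ = below (t ++ b :: s) z) //.
    apply/funext => u; rewrite /below; congr z.
    by rewrite cat_rcons -!catA /= catA cat_take_drop.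
  by case: b {hs} A => A; [apply: h1; apply: A; lia | apply: h0; apply: A; lia].
have [nxt nxtP] := choice QS.
pose node := fix node n := if n is m.+1 then rcons (node m) (nxt (node m)) else [::].
have Qn n : Q (node n) by elim: n => [|n IHn] //=; exact: nxtP.
exists (nxt \o node) => n.
have -> : mkseq (nxt \o node) n = node n.
  by elim: n => [|n IHn] //; rewrite mkseqS IHn.
by have [s /size0nil ->] := Qn n 0%N; rewrite cats0.
Qed.

End Pairing.

(** * Tails concentrating along one branch *)

Section Branch.
Variables (R : realType) (k : nat).
Implicit Types (G H F E z : seq bool -> R) (t s : seq bool) (b : bool).

(** As [E] vanishes below [s], only the one segment running into the subtree at [s] feels both
    functions; its start value is at most [X], so it adds at most (2X)^p. *)
Lemma pvar_add_graft n E s H u X c : below s E = (fun=> 0) ->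
  H [::] = 0 -> (forall t, `|E t| <= X) -> (forall t, `|H t| <= X) ->
  (forall m, pvar k m H 0 <= c) -> `|u| <= X ->
  pvar k n (E + graft s H) u <= pvar k n E u + c + epow k (2 * X).
Proof.
move=> + H0 + HX Hc; elim: s n E u => [|b s IHs] n E u Es EX uX.
  have -> : E = fun=> 0 by exact: Es.
  have -> : (fun=> 0) + graft [::] H = H by apply/funext => t; rewrite fctE add0r.
  apply: le_trans (pvar_shift k n u HX) _.
  have : epow k (X + `|u|) <= epow k (2 * X).
    apply: ler_epow; have := normr_ge0 u => u0.
    by rewrite [leLHS]ger0_norm ?[leRHS]ger0_norm; lra.
  by have := Hc n; have := pvar_ge0 k n (fun=> 0) u; lra.
have c0 : 0 <= c by exact: le_trans (pvar_ge0 k 0 H 0) (Hc 0%N).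
have e0 : (E + graft (b :: s) H) [::] = E [::] by rewrite fctE addr0.
have eb : child b (E + graft (b :: s) H) = child b E + graft s H.
  by rewrite -[in RHS](child_graft b).
have eb' : child (~~ b) (E + graft (b :: s) H) = child (~~ b) E.
  by apply/funext => t; rewrite /child fctE /=; case: b {Es e0 eb}; rewrite addr0.
have hb v : `|v| <= X ->
    pvar k n.-1 (child b E + graft s H) v <=
    pvar k n.-1 (child b E) v + c + epow k (2 * X).
  by move=> vX; apply: IHs => // t; exact: EX.
case: n hb => [|n] hb.
  by rewrite /= e0; have := epow_ge0 k (2 * X); lra.
apply: pvarS_le => d; have := pvarS_ge k d n E u.
have [->|->] : d = b \/ d = ~~ b by case: d b {Es e0 eb eb' hb} => [] []; auto.
- by rewrite eb eb' e0; have := hb _ uX; lra.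
- by rewrite negbK eb eb' e0; have := hb _ (EX [::]); lra.
Qed.

(** Grafted at a node where a function has settled at the value [a], it cancels that value in the
    child [b] and doubles it in the sibling. *)
Definition fork (b : bool) (a : R) : seq bool -> R :=
  fun t => if t is c :: _ then if c == b then - a else a else 0.

Lemma martingale_fork b a : martingale (fork b a).
Proof.
by move=> [|c t]; rewrite /fork /= ; [case: b => /=; lra | case: ifP => _; lra].
Qed.

Lemma child_fork b a c : child c (fork b a) = fun=> if c == b then - a else a.
Proof. by []. Qed.

Lemma pvar_fork n b a : `|a| <= 1 -> pvar k n (fork b a) 0 <= 2.
Proof.
rewrite -(epow_le1 k) => a1; case: n => [|n]; first by rewrite /= subrr epow0.
rewrite pvarS0 // !child_fork !pvar_const !subr0.
by case: b => /=; rewrite epowN; lra.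
Qed.

Lemma pairing_fork n b a x : additive x ->
  pairing n.+1 x (fork b a) = a * (x [:: ~~ b] - x [:: b]).
Proof.
move=> ax /=; rewrite !child_fork !pairing_const; try exact: additive_child.
by case: b; rewrite /child /=; lra.
Qed.

Section BranchBlocks.
Variables (z : seq bool -> R) (g : nat -> bool) (c : R).
Hypothesis az : additive z.
Hypothesis z_bounded : forall G n, unit_test k G -> pairing n z G <= 1.
Hypothesis z_small : forall (e : R) n, 0 < e ->
  exists2 l, (n <= l)%N & forall t, size t = l -> `|z t| <= e.
Hypothesis c_gt0 : 0 < c.
Hypothesis tail_g : forall n, has_tail k c (below (mkseq g n) z).

(* Each block is forced back to 0 at a node of the branch where z is tiny, so
   that consecutive blocks concatenate without accumulating along the branch. *)
Lemma branch_blocks K n : exists H M,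
  [/\ martingale H, H [::] = 0, forall t, `|H t| <= 2,
      forall N, pvar k N H 0 <= K%:R * (3 * epow k 2 + epow k 4)
    & forall N, (M <= N)%N ->
        K%:R * (c / 2) <= pairing N (below (mkseq g n) z) H].
Proof.
elim: K n => [|K IHK] n.
  exists (fun=> 0), 0%N; split => //.
  - exact: martingale0.
  - by move=> t; rewrite normr0.
  - by move=> N; rewrite pvar_const subrr epow0 mul0r.
  - by move=> N _; rewrite mul0r pairing_0r.
have [G [m [tG vG cG]]] := tail_g n 0.
pose F := trunc m G.
have tF : unit_test k F by exact: unit_test_trunc.
have F0 : F [::] = 0 by apply: vG.
have c4 : 0 < c / 4 by rewrite divr_gt0.
have [l lmn zl] := z_small (n + m).+1 c4.
(* The fork will sit at depth [j], so that its two children lie exactly on level [l] of the tree,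
   where [z] is tiny; and j >= m makes [F] constant below it. *)
pose j := (l - n.+1)%N.
have [H [M [mH H0 H2 HK HM]]] := IHK (n + j.+1)%N.
pose r := mkseq (fun i => g (n + i)%N) j; pose b := g (n + j)%N.
have sr : size r = j by rewrite size_mkseq.
have es : rcons r b = mkseq (fun i => g (n + i)%N) j.+1 by rewrite mkseqS.
set s := rcons r b in es *.
have ss : size s = j.+1 by rewrite size_rcons sr.
have ens : mkseq g n ++ s = mkseq g (n + j.+1).
  apply: (@eq_from_nth _ false); rewrite size_cat ss !size_mkseq // => i hi.
  rewrite nth_cat size_mkseq [RHS]nth_mkseq //; case: ltnP => h.
    by rewrite nth_mkseq.
  by rewrite es nth_mkseq ?subnKC //; lia.
pose a := F r.
have a1 : `|a| <= 1 by exact: unit_test_le1 tF.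
(* [E] is 0 below the node [s] of the branch, where the next block gets grafted. *)
pose E := F + graft r (fork b a).
have [mg g0] := martingale_graft r (martingale_fork b a) (erefl _).
have mE : martingale E by apply: martingaleD => //; case: tF.
have E0 : E [::] = 0 by rewrite /E fctE F0 g0 addr0.
have Es : below s E = fun=> 0.
  apply/funext => t; rewrite /below /E fctE /s cat_rcons graft_cat /= eqxx.
  by rewrite /a /F /trunc takel_cat ?subrr // sr /j; lia.
have E2 t : `|E t| <= 2.
  rewrite /E fctE; apply: le_trans (ler_normD _ _) _.
  have : `|F t| <= 1 by exact: unit_test_le1 tF.
  have : `|graft r (fork b a) t| <= 1.
    have [[u [_ ->]]|->] := graftE r (fork b a) t; last by rewrite normr0.
    rewrite /fork; case: u => [|d u]; first by rewrite normr0.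
    by case: ifP; rewrite ?normrN.
  by lra.
have EK N : pvar k N E 0 <= 3 * epow k 2.
  have := pvarD k N F (graft r (fork b a)) 0 0; rewrite addr0 => /le_trans; apply.
  rewrite mulrC; apply: ler_wpM2r; first exact: epow_ge0.
  have : pvar k N (graft r (fork b a)) 0 <= 2.
    by apply: pvar_graft_le => // q; exact: pvar_fork.
  by have := tF.2 N; lra.
have [mgH gH0] := martingale_graft s mH H0.
exists (E + graft s H), (j.+1 + M + m)%N; split.
- exact: martingaleD.
- by rewrite fctE E0 gH0 addr0.
- move=> t; rewrite fctE; have [[u [-> ->]]|->] := graftE s H t.
    by rewrite -[E _]/(below s E u) Es add0r.
  by rewrite addr0.
- move=> N; apply: le_trans (pvar_add_graft N Es H0 E2 H2 HK _) _.
    by rewrite normr0.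
  have -> : 2 * 2 = 4 :> R by lra.
  rewrite -[K.+1]addn1 natrD mulrDl mul1r.
  by have := EK N; lra.
- move=> N hN; rewrite !pairingDr.
  set x := below (mkseq g n) z.
  have ax : additive x by exact: additive_below.
  rewrite pairing_trunc //; last by lia.
  have -> : N = (size r + (N - j.+1).+1)%N by rewrite sr; lia.
  rewrite pairing_graft pairing_fork; last exact: additive_below.
  have -> : (size r + (N - j.+1).+1)%N = (size s + (N - j.+1))%N.
    by rewrite sr ss addnS.
  rewrite pairing_graft.
  have -> : below s x = below (mkseq g (n + j.+1)) z.
    by apply/funext => t; rewrite /x /below catA ens.
  have h3 := HM (N - j.+1)%N ltac:(lia).
  have zx d : `|below r x [:: d]| <= c / 4.
    apply: zl; rewrite !size_cat size_mkseq sr /= /j; lia.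
  have h1 := zx b; have h2 := zx (~~ b).
  (* The fork costs at most half of the [c] gained from [G]. *)
  have : `|a * (below r x [:: ~~ b] - below r x [:: b])| <= c / 2.
    rewrite normrM; apply: (@le_trans _ _ (1 * (c / 2))); last by rewrite mul1r.
    apply: ler_pM => //; apply: le_trans (ler_normB _ _) _; lra.
  rewrite ler_norml => /andP[h4 _].
  rewrite -[K.+1]addn1 natrD mulrDl mul1r.
  lra.
Qed.

Lemma branch_tail_false : False.
Proof.
pose C := 3 * epow k 2 + epow k 4 : R.
have C0 : 0 <= C by rewrite /C; have := epow_ge0 k (2 : R); have := epow_ge0 k (4 : R); lra.
(* With L = K c / 4, the variation K C is at most L^2 <= L^p, so H / L is a unit test; its pairing
   with [z] is at least (K c / 2) / L = 2, against the bound 1. *)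
have [K hK1 hK2] : exists2 K : nat, 1 <= K%:R * (c / 4) &
    K%:R * C <= (K%:R * (c / 4)) ^+ 2.
  pose B := (c / 4)^-1 + C / (c / 4) ^+ 2.
  have [K hK] : exists K : nat, B <= K%:R.
    exists (Num.truncn B).+1; apply: ltW; exact: truncnS_gt.
  have c4 : 0 < c / 4 by rewrite divr_gt0.
  have i0 : 0 < (c / 4)^-1 by rewrite invr_gt0.
  have q0 : 0 <= C / (c / 4) ^+ 2 by rewrite divr_ge0 ?sqr_ge0.
  exists K; first by rewrite -ler_pdivrMr // mul1r; rewrite /B in hK; lra.
  have hq : C / (c / 4) ^+ 2 <= K%:R by rewrite /B in hK; lra.
  rewrite ler_pdivrMr ?exprn_gt0 // in hq.
  by rewrite exprMn expr2 -mulrA; apply: ler_wpM2l => //; rewrite ler0n.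
have [H [M [mH H0 _ HK HM]]] := branch_blocks K 0.
set L := K%:R * (c / 4) in hK1 hK2.
have L0 : 0 < L by lra.
have tH : unit_test k (fun t => L^-1 * H t).
  apply: unit_testZ => // n.
  have eL : epow k L^-1 * epow k L = 1.
    by rewrite -epowM mulVf ?epow1 // gt_eqF.
  rewrite -eL; apply: ler_wpM2l; first exact: epow_ge0.
  apply: le_trans (HK n) (le_trans hK2 _).
  by apply: epow_ge_sqr; rewrite ger0_norm // ltW.
have := z_bounded M tH; rewrite pairingZr.
have -> : z = below (mkseq g 0) z by [].
rewrite mulrC ler_pdivrMr // mul1r => h.
have := HM M (leqnn M) => /le_trans /(_ h).
by rewrite -/L /L; rewrite /L in L0; lra.
Qed.
End BranchBlocks.
End Branch.

(** * Tails dispersed over the tree; non-existence of [z] *)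

Section Dispersed.
Variables (R : realType) (k : nat).
Implicit Types (G H F z : seq bool -> R) (t s : seq bool) (b : bool).

Definition node_case (v : R) (f : bool -> seq bool -> R) : seq bool -> R :=
  fun t => if t is b :: t' then f b t' else v.

Lemma martingale_node_case (f : bool -> seq bool -> R) :
  (forall b, martingale (f b)) -> (forall b, f b [::] = 0) ->
  martingale (node_case 0 f).
Proof. by move=> mf f0 [|b t] /=; rewrite ?f0 ?addr0 ?mul0r // mf. Qed.

Lemma pvar_vanishesS n G : G [::] = 0 ->
  pvar k n.+1 G 0 = \sum_b pvar k n (child b G) 0.
Proof. by move=> G0; rewrite pvarS0 // big_bool /= addrC. Qed.

(** The subtrees at level [l] on which the variation of [G] exceeds [r] are cut out. Each costs at
    most [e] in the pairing, hence at most e / r times its own variation, and these variations add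
    up to at most that of [G]. From level [N0] on the excess is visible. *)
Lemma prune l M z G (r e : R) : 0 < r -> 0 <= e -> (l <= M)%N ->
  martingale G -> vanishes l G -> (forall N, pvar k N G 0 <= 1) ->
  (forall s H m, size s = l -> unit_test k H -> H [::] = 0 ->
     pairing m (below s z) H <= e) ->
  exists F N0, [/\ martingale F, vanishes l F,
    forall N, pvar k N F 0 <= pvar k N G 0,
    forall s N, size s = l -> pvar k N (below s F) 0 <= r
    & forall N, (N0 <= N)%N ->
      pairing M z G - e / r * pvar k N G 0 <= pairing M z F].
Proof.
move=> r0 e0; elim: l M z G => [|l IHl] M z G lM mG vG G1 ze.
  have er : 0 <= e / r by rewrite divr_ge0 // ltW.
  case: (pselect (forall N, pvar k N G 0 <= r)) => h.
    exists G, 0%N; split => // [s N /size0nil -> //|N _].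
    by rewrite lerBlDr lerDl mulr_ge0 // pvar_ge0.
  have /existsNP[N1 /negP] := h; rewrite -ltNge => hN.
  exists (fun=> 0), N1; split => //.
  - exact: martingale0.
  - by move=> N; rewrite pvar_const subrr epow0 pvar_ge0.
  - by move=> s N _; rewrite pvar_const subrr epow0 ltW.
  - move=> N hN1; rewrite [leRHS]pairing_0r // subr_le0.
    have := ze [::] G M erefl (conj mG G1) (vG [::] isT).
    move=> /le_trans; apply; rewrite mulrAC ler_pdivlMr //.
    apply: ler_wpM2l => //; apply: le_trans (ltW hN) _; exact: pvar_mono.
case: M lM => // M lM.
have G0 : G [::] = 0 by exact: vG.
have hb b : exists FN : (seq bool -> R) * nat,
  [/\ martingale FN.1, vanishes l FN.1,
    forall N, pvar k N FN.1 0 <= pvar k N (child b G) 0,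
    forall s N, size s = l -> pvar k N (below s FN.1) 0 <= r
    & forall N, (FN.2 <= N)%N ->
      pairing M (child b z) (child b G) - e / r * pvar k N (child b G) 0
       <= pairing M (child b z) FN.1].
  have [] := IHl M (child b z) (child b G) lM.
  - exact: martingale_child.
  - by move=> t ht; apply: vG.
  - move=> N; apply: le_trans (G1 N.+1); have := pvarS_ge k b N G 0.
    by rewrite G0; have := pvar_ge0 k N (child (~~ b) G) 0; lra.
  - by move=> s H m hs tH H0; apply: (ze (b :: s)) => //=; rewrite hs.
  by move=> F [N0 h]; exists (F, N0).
have [f fP] := choice hb.
have f0 b : (f b).1 [::] = 0 by have [_ v _ _ _] := fP b; apply: v.
exists (node_case 0 (fun b => (f b).1)), (maxn (f false).2 (f true).2).+1; split.
- by apply: martingale_node_case => // b; have [] := fP b.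
- by move=> [|b t] //= ht; have [_ v _ _ _] := fP b; apply: v.
- case=> [|N]; first by rewrite /= G0.
  rewrite !pvar_vanishesS //; apply: ler_sum => b _.
  by have [_ _ + _ _] := fP b; apply.
- by move=> [|b s] // N [hs]; have [_ _ _ + _] := fP b; apply.
- case=> // N; rewrite ltnS geq_max => /andP[h1 h2].
  have [_ _ _ _ /(_ _ h1)] := fP false; have [_ _ _ _ /(_ _ h2)] := fP true.
  rewrite pvar_vanishesS // big_bool /= mulrDr.
  rewrite -![child _ (node_case _ _)]/(f _).1; lra.
Qed.

(* Far down the tree the increments of F' are negligible compared with every
   nonzero increment of F, so a segment prolonging one of F gains at most a
   factor, and the others only see F'. *)
Lemma pvar_add_small l N F F' u (e d : R) : 0 < d -> 0 <= e ->
  martingale F' -> vanishes l F' ->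
  (forall s t, size s = l -> F (s ++ t) = F s) ->
  (forall s n, size s = l -> pvar k n (below s F') 0 <= epow k (e * d)) ->
  (forall t, F t = u \/ d <= `|F t - u|) ->
  (forall t s, F t = F s \/ d <= `|F t - F s|) ->
  pvar k N (F + F') u <= epow k (1 + e) * pvar k N F u + pvar k N F' 0.
Proof.
move=> d0 e0; have e1 : 1 <= epow k (1 + e).
  by rewrite -[leLHS](epow1 R k); apply: ler_epow; rewrite normr1 ler_normr; apply/orP; left; lra.
elim: l N F F' u => [|l IHl] N F F' u mF' vF' Fc F'e Fu FF.
  (* From here on [F] is constant: the open segment has either no increment of [F], and sees only
     [F'], or one of size at least [d], against which |F'| <= e d. *)
  have {}Fc t : F t = F [::] by exact: (Fc [::]).
  have -> : pvar k N (F + F') u = pvar k N F' (u - F [::]).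
    rewrite -(pvar_translate k N _ u (F [::])); apply: pvar_eq => t _.
    by rewrite fctE Fc addrAC subrr add0r.
  have -> : pvar k N F u = epow k (F [::] - u).
    by rewrite -(pvar_const k N (F [::])); apply: pvar_eq => t _.
  have [-> | dF] := Fu [::].
    by rewrite subrr epow0 mulr0 add0r.
  have F'X t : `|F' t| <= e * d.
    have ed : 0 <= e * d by rewrite mulr_ge0 // ltW.
    rewrite -(ger0_norm ed) -(ler_pXn2r (_ : 0 < (k.+1).*2)%N) ?nnegrE //.
    rewrite -!/(epow k _) !epow_norm.
    apply: le_trans (F'e [::] (size t) erefl).
    by have := pvar_node k 0 mF' (leqnn (size t)); rewrite subr0.
  apply: le_trans (pvar_shift k N _ F'X) _.
  rewrite addrC lerD2r -epowM; apply: ler_epow.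
  rewrite normrM (ger0_norm (_ : 0 <= 1 + e)); last by lra.
  rewrite [leLHS]ger0_norm; last by rewrite addr_ge0 // mulr_ge0 // ltW.
  rewrite distrC mulrDl mul1r addrC lerD2l.
  exact: ler_wpM2l.
have F'0 : F' [::] = 0 by exact: vF'.
have FF'0 : (F + F') [::] = F [::] by rewrite fctE F'0 addr0.
have hb b v : (forall t, F t = v \/ d <= `|F t - v|) ->
    pvar k N.-1 (child b (F + F')) v <=
    epow k (1 + e) * pvar k N.-1 (child b F) v + pvar k N.-1 (child b F') 0.
  move=> Fv; apply: IHl.
  - exact: martingale_child.
  - by move=> t ht; apply: vF'.
  - by move=> s t hs; apply: (Fc (b :: s)); rewrite /= hs.
  - by move=> s n hs; apply: (F'e (b :: s)); rewrite /= hs.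
  - by move=> t; exact: Fv.
  - by move=> t s; exact: FF.
case: N hb => [|N] hb.
  rewrite /= FF'0 F'0 subrr epow0 addr0 -[leLHS]mul1r.
  by apply: ler_wpM2r; rewrite ?epow_ge0.
apply: pvarS_le => b; rewrite FF'0.
have := hb b u Fu; have := hb (~~ b) (F [::]) (fun t => FF t [::]).
have := pvarS_ge k b N F u; have := pvarS_ge k b N F' 0; rewrite F'0 /=.
have ee : 0 <= epow k (1 + e) by exact: epow_ge0.
by move=> h1 /(ler_wpM2l ee) + h3 h4; lra.
Qed.

Lemma trunc_finite m F : exists L : seq R, forall t, trunc m F t \in L.
Proof.
elim: m F => [|m IHm] F.
  by exists [:: F [::]] => t; rewrite /trunc take0 inE.
have [L0 h0] := IHm (child false F); have [L1 h1] := IHm (child true F).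
exists (F [::] :: L0 ++ L1) => -[|b t]; first by rewrite inE eqxx.
rewrite inE mem_cat; apply/orP; right.
by case: b; [rewrite orbC (h1 t) | rewrite (h0 t)].
Qed.

(** Provides a lower bound for the nonzero increments of a truncated martingale. *)
Lemma finite_gap (L : seq R) : exists2 d : R, 0 < d &
  forall a b : R, a \in L -> b \in L -> a = b \/ d <= `|a - b|.
Proof.
have gap1 (a : R) : exists2 d : R, 0 < d & forall b : R, b \in L -> a = b \/ d <= `|a - b|.
  elim: L => [|c L [d d0 hd]]; first by exists 1.
  have [ac|ac] := eqVneq a c.
    by exists d => // b; rewrite inE -ac => /orP[/eqP ->|/hd]; [left|].
  exists (Num.min d `|a - c|); first by rewrite lt_min d0 normr_gt0 subr_eq0.
  move=> b; rewrite inE => /orP[/eqP ->|/hd [->|h]]; [right|by left|right].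
    by rewrite ge_min lexx orbT.
  by rewrite ge_min h.
have gap1' (a : R) : exists d : R,
    0 < d /\ forall b : R, b \in L -> a = b \/ d <= `|a - b|.
  by have [d d0 hd] := gap1 a; exists d.
have [f fP] := choice gap1'.
have gap2 (L' : seq R) : exists2 d : R, 0 < d &
    forall a b : R, a \in L' -> b \in L -> a = b \/ d <= `|a - b|.
  elim: L' => [|c L' [d d0 hd]]; first by exists 1.
  have [fc0 fc] := fP c.
  exists (Num.min d (f c)); first by rewrite lt_min d0.
  move=> a b; rewrite inE => /orP[/eqP -> /fc|/hd h /h] [->|h'];
    by [left | right; rewrite ge_min h' ?orbT].
exact: gap2.
Qed.

Lemma uniform_level n (P : seq bool -> nat -> Prop) :
  (forall t i j, (i <= j)%N -> P t i -> P t j) ->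
  (forall t, size t = n -> exists i, P t i) ->
  exists i, forall t, size t = n -> P t i.
Proof.
elim: n P => [|n IHn] P Pm h.
  by have [i hi] := h [::] erefl; exists i => t /size0nil ->.
have hb b : exists i, forall t, size t = n -> P (b :: t) i.
  apply: (IHn (fun t => P (b :: t))) => [t|t ht]; first exact: Pm.
  by apply: h; rewrite /= ht.
have [i0 h0] := hb false; have [i1 h1] := hb true.
exists (maxn i0 i1) => -[|b t] // [ht]; case: b.
  by apply: Pm (h1 t ht); exact: leq_maxr.
by apply: Pm (h0 t ht); exact: leq_maxl.
Qed.

Section DispersedTail.
Variables (z : seq bool -> R) (c : R).
Hypothesis az : additive z.
Hypothesis z_bounded : forall G n, unit_test k G -> pairing n z G <= 1.
Hypothesis c_gt0 : 0 < c.
Hypothesis tail_z : has_tail k c z.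
Hypothesis dispersed : forall e : R, 0 < e ->
  exists n, forall t, size t = n -> ~ has_tail k e (below t z).

(** One depth [i] serves all nodes of level [n]. Below level n + i, a test at [s] becomes by
    grafting a test at the ancestor of [s] on level [n], vanishing up to depth [i]. *)
Lemma dispersed_uniform (e : R) : 0 < e -> exists l, forall l' s H m,
  (l <= l')%N -> size s = l' -> unit_test k H -> H [::] = 0 ->
  pairing m (below s z) H <= e.
Proof.
move=> e0; have [n hn] := dispersed e0.
pose P t i := forall H m, unit_test k H -> vanishes i H ->
  pairing m (below t z) H <= e.
have [t i j ij h H m tH vH| |i hi] := @uniform_level n P.
- by apply: h => // u ui; apply: vH; exact: leq_trans ij.
- move=> t /hn /existsNP[i hi]; exists i => H m tH vH.
  by rewrite leNgt; apply/negP => h; apply: hi; exists H, m.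
exists (n + i)%N => l' s H m nl sl tH H0.
rewrite -(cat_take_drop n s) in sl *.
set t := take n s in sl *; set u := drop n s in sl *.
have tn : size t = n by rewrite size_takel //; move: sl; rewrite cat_take_drop; lia.
have -> : below (t ++ u) z = below u (below t z).
  by apply/funext => v; rewrite /below catA.
rewrite -(@pairing_graft R u m); apply: (hi t tn).
  exact: unit_test_graft.
move=> v hv; apply: graft_size => //; apply: leq_trans hv _.
by move: sl; rewrite size_cat tn; lia.
Qed.

Lemma dispersed_tail_false : False.
Proof.
pose S := [set d : R | has_tail k d z].
have S0 : S !=set0 by exists c.
have S1 : ubound S 1.
  move=> d /(_ 0%N)[G [m [tG _ dG]]]; apply: ltW; apply: lt_le_trans dG _.
  exact: z_bounded.
have hS : has_sup S by split => //; exists 1.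
(* Tests above 9/10 v occur at every depth, but far enough down none exceeds 11/10 v; the sum of two
   of the former will violate this. *)
pose v := sup S.
have v0 : 0 < v by apply: lt_le_trans c_gt0 _; apply: ub_le_sup => //; exists 1.
have tail_v : has_tail k (9 / 10 * v) z.
  have v10 : 0 < v / 10 by rewrite divr_gt0.
  have [d Sd dv] := sup_adherent v10 hS.
  by apply: has_tail_mono Sd; rewrite -/v in dv; lra.
have [n hn] : exists n, forall G m, unit_test k G -> vanishes n G ->
    pairing m z G <= 11 / 10 * v.
  have : ~ has_tail k (11 / 10 * v) z.
    by move=> /(ub_le_sup (ex_intro _ 1 S1)); rewrite -/v; lra.
  move=> /existsNP[n h]; exists n => G m tG vG.
  by rewrite leNgt; apply/negP => h'; apply: h; exists G, m.
have [G1 [m [tG1 vG1 hG1]]] := tail_v n.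
pose F := trunc m G1.
have tF : unit_test k F by exact: unit_test_trunc.
have vF : vanishes n F.
  by move=> t tn; apply: vG1; rewrite size_take_min geq_min tn orbT.
have [L hL] := trunc_finite m G1; have [d d0 hd] := finite_gap L.
pose e : R := (8 * (k.+1).*2%:R)^-1.
have e0 : 0 < e by rewrite invr_gt0 mulr_gt0 ?ltr0n.
pose r := epow k (e * d).
have r0 : 0 < r by rewrite lt_def epow_ge0 epow_eq0 gt_eqF // mulr_gt0.
(* With this bound on the subtrees, pruning at threshold [r] loses at most v / 10. *)
have er : 0 < r * (v / 10) by rewrite mulr_gt0 // divr_gt0.
have [l0 hl0] := dispersed_uniform er.
pose l := (l0 + n + m)%N.
have [G2 [M [[mG2 G21] vG2 hG2]]] := tail_v l.
have lM : (l <= M)%N.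
  rewrite leqNgt; apply/negP => Ml; move: hG2; rewrite pairing_0r ?ltNge; last first.
    by move=> t tM; apply: vG2; rewrite tM ltnW.
  by rewrite mulr_ge0 // ltW.
have ze s H q : size s = l -> unit_test k H -> H [::] = 0 ->
    pairing q (below s z) H <= r * (v / 10).
  by apply: hl0; rewrite /l; lia.
have [F' [N0 [mF' vF' F'G F'r hF']]] := prune r0 (ltW er) lM mG2 vG2 G21 ze.
have hP : 8 / 10 * v <= pairing M z F'.
  have := hF' N0 (leqnn _).
  have -> : r * (v / 10) / r = v / 10 by field; rewrite gt_eqF.
  have : v / 10 * pvar k N0 G2 0 <= v / 10 by rewrite ler_piMr // divr_ge0 // ltW.
  by lra.
(* The variation is at most (2/3)^2 (5/4 + 1) = 1, while the pairing is at least 2/3 (9/10 + 8/10) v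
   > 11/10 v. *)
have tFF : unit_test k (fun t => 2 / 3 * (F + F') t).
  apply: unit_testZ => [|N]; first by apply: martingaleD => //; case: tF.
  have : pvar k N (F + F') 0 <= epow k (1 + e) * pvar k N F 0 + pvar k N F' 0.
    apply: (@pvar_add_small l _ _ _ _ e d) => //.
    - exact: ltW.
    - move=> s t sl; rewrite /F /trunc takel_cat // sl /l; lia.
    - by move=> t; rewrite -(vF [::] isT); exact: hd.
    - by move=> t s; exact: hd.
  have h1 := epow_near1 R k; rewrite -/e in h1.
  have h2 := tF.2 N; have h3 := le_trans (F'G N) (G21 N).
  have h4 : epow k (1 + e) * pvar k N F 0 <= (1 + 4^-1) * 1.
    by apply: ler_pM; rewrite ?epow_ge0 ?pvar_ge0.
  have h5 : epow k (2 / 3) <= (2 / 3) ^+ 2 :> R.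
    by apply: epow_le_sqr; rewrite ger0_norm; lra.
  have h6 := epow_ge0 k (2 / 3 : R); have h7 := pvar_ge0 k N (F + F') 0.
  move=> h8; apply: le_trans (ler_pM h6 h7 h5 (le_trans h8 (lerD h4 h3))) _.
  lra.
have vFF : vanishes n (fun t => 2 / 3 * (F + F') t).
  by move=> t tn; rewrite fctE vF // vF' ?addr0 ?mulr0 // /l; lia.
have := hn _ M tFF vFF; rewrite pairingZr pairingDr pairing_trunc //; last first.
  by rewrite /l in lM; lia.
lra.
Qed.
End DispersedTail.

(* The z satisfying the first two hypotheses are the elements of the unit ball of
   the bidual. *)
Theorem no_tail z c : additive z ->
  (forall G n, unit_test k G -> pairing n z G <= 1) ->
  (forall (e : R) n, 0 < e ->
    exists2 l, (n <= l)%N & forall t, size t = l -> `|z t| <= e) ->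
  0 < c -> ~ has_tail k c z.
Proof.
move=> az z1 zs c0 tz.
apply: (dispersed_tail_false az z1 c0 tz) => e e0.
apply/not_existsP => h.
have [n|g hg] := @koenig_tail R k e z.
  have /existsNP[t /not_implyP[tn /contrapT ht]] := h n.
  by exists t.
exact: (branch_tail_false az z1 zs e0 hg).
Qed.

End Dispersed.

(** * Cylinder indicators as tests *)

Section NodeTest.
Variables (R : realType) (k : nat).
Implicit Types (G x : seq bool -> R) (t s : seq bool).

(* The martingale closed by the indicator function of the cylinder of t. *)
Fixpoint node_test t : seq bool -> R :=
  if t is b :: t' then
    fun s => if s is c :: s' then if c == b then node_test t' s' else 0
             else node_test t' [::] / 2
  else fun=> 1.

Lemma child_node_test b t : child b (node_test (b :: t)) = node_test t.
Proof. by apply/funext => s; rewrite /child /= eqxx. Qed.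

Lemma childN_node_test b t : child (~~ b) (node_test (b :: t)) = fun=> 0.
Proof. by apply/funext => s; rewrite /child /=; case: b. Qed.

Lemma martingale_node_test t : martingale (node_test t).
Proof.
elim: t => [|b t IHt] s /=; first by lra.
case: s => [|c s] /=; first by case: b => /=; lra.
by case: ifP => _; [exact: IHt | lra].
Qed.

Lemma node_test_root t : node_test t [::] = 2^-1 ^+ size t.
Proof. by elim: t => //= b t ->; rewrite exprSr. Qed.

Lemma node_test_root01 t : 0 < node_test t [::] <= 1.
Proof.
rewrite node_test_root exprn_gt0 ?invr_gt0 //= exprn_ile1 ?invr_ge0 //.
by rewrite invf_le1 ?ler1n.
Qed.

(** Subtracting the root value closes the induction: one more letter halves the root value [a], and
    the a / 2 gained pays for the segment entering the zero child, since v^p <= v on [0, 1]. *)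
Lemma pvar_node_test n t u : 0 <= u -> u <= node_test t [::] ->
  pvar k n (node_test t) u <= 2 - node_test t [::].
Proof.
elim: t n u => [|b t IHt] n u u0 u1.
  rewrite /= in u1 *; rewrite pvar_const; have -> : 2 - 1 = 1 :> R by lra.
  by rewrite epow_le1 ger0_norm; lra.
have /andP[g0 g1] := node_test_root01 t.
have e : node_test (b :: t) [::] = node_test t [::] / 2 by [].
rewrite e in u1 *; set a := node_test t [::] in e u1 g0 g1 *.
have wle v : 0 <= v -> v <= a / 2 -> epow k v <= a / 2.
  by move=> v0 va; apply: le_trans (va); apply: epow_le_id => //; lra.
case: n => [|n].
  have := wle (a / 2 - u) ltac:(lra) ltac:(lra); rewrite /= -/a; lra.
have h v : 0 <= v -> v <= a / 2 -> pvar k n (node_test t) v <= 2 - a.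
  by move=> v0 va; apply: IHt => //; rewrite -/a; lra.
apply: pvarS_le => d; rewrite e -/a.
have [->|->] : d = b \/ d = ~~ b by case: d b {e} => [] []; auto.
  rewrite child_node_test childN_node_test pvar_const sub0r epowN.
  by have := h u u0 u1; have := wle (a / 2) ltac:(lra) ltac:(lra); lra.
rewrite negbK child_node_test childN_node_test pvar_const sub0r epowN.
by have := wle u u0 u1; have := h (a / 2) ltac:(lra) ltac:(lra); lra.
Qed.

Lemma unit_test_node t : unit_test k (fun s => 2^-1 * node_test t s).
Proof.
have /andP[g0 g1] := node_test_root01 t.
apply: unit_testZ => [|n]; first exact: martingale_node_test.
have h1 : epow k 2^-1 <= 2^-1 :> R by apply: epow_le_id; lra.
have h2 : pvar k n (node_test t) 0 <= 2.
  by have := @pvar_node_test n t 0 (lexx _) (ltW g0); lra.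
apply: le_trans (ler_pM _ _ h1 h2) _; rewrite ?epow_ge0 ?pvar_ge0 //.
by rewrite mulVf.
Qed.

Lemma pairing_node_test n t x : (n <= size t)%N ->
  pairing n x (node_test t) = x (take n t) * 2^-1 ^+ (size t - n).
Proof.
elim: n t x => [|n IHn] t x; first by rewrite /= take0 subn0 node_test_root.
case: t => // b t nt.
have E c : pairing n (child c x) (child c (node_test (b :: t))) =
    if c == b then x (b :: take n t) * 2^-1 ^+ (size t - n) else 0.
  case: eqP => [->|/eqP cb]; first by rewrite child_node_test IHn.
  have -> : c = ~~ b by move: cb; case: b c {nt} => [] [].
  by rewrite childN_node_test pairing_0r.
by rewrite [LHS]/= !E; case: b {nt E} => /=; rewrite ?add0r ?addr0 subSS.
Qed.

End NodeTest.

(** * The space and its norm *)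

Section Space.
Variables (R : realType) (k : nat).
Implicit Types (G x y : seq bool -> R) (t s : seq bool).

Definition tail_le n (e : R) x := forall G m,
  unit_test k G -> (n <= m)%N -> `|pairing m x G - pairing n x G| <= e.

(** Convergence of the pairings uniformly over unit tests; this singles out the closure of the
    simple elements, see [simple_tree] and [simple_dense]. *)
Definition null_tail x := forall e : R, 0 < e -> exists n, tail_le n e x.

(** [G] is replaced by its tail after level [n'], again a unit test, whose pairing at level [n] is
    0. *)
Lemma tail_leW n n' e x : additive x -> (n <= n')%N -> tail_le n e x ->
  tail_le n' e x.
Proof.
move=> ax nn' h G m tG nm; rewrite -pairing_tail //.
have := h _ m (unit_test_tail n' tG) (leq_trans nn' nm).
rewrite [X in _ - X]pairing_0r ?subr0 // => t tn.
by rewrite /tail take_oversize ?subrr // tn.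
Qed.

Definition tree_pred : {pred seq bool -> R} :=
  mem [set x | additive x /\ null_tail x].

Lemma tree_predP x : reflect (additive x /\ null_tail x) (x \in tree_pred).
Proof. by apply: (iffP idP); rewrite inE. Qed.

Lemma pairing_lin n a x y G :
  pairing n (a *: x + y) G = a * pairing n x G + pairing n y G.
Proof. by rewrite pairingDl -pairingZl. Qed.

Lemma pairing_0l n G : pairing n (0 : seq bool -> R) G = 0.
Proof. by elim: n G => [|n IHn] G /=; rewrite ?mul0r // !IHn addr0. Qed.

Lemma tree_submod_closed : submod_closed tree_pred.
Proof.
split.
  apply/tree_predP; split=> [t|e e0]; first by apply/esym; exact: addr0.
  by exists 0%N => G m _ _; rewrite !pairing_0l subr0 normr0 ltW.
move=> a x y /tree_predP[ax nx] /tree_predP[ay ny]; apply/tree_predP; split=> [t|e e0].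
  change (a * x t + y t =
    a * x (rcons t false) + y (rcons t false) +
    (a * x (rcons t true) + y (rcons t true))).
  by rewrite ax ay mulrDr addrACA.
have a1 : 0 < `|a| + 1 by rewrite ltr_wpDl.
have e1 : 0 < e / 2 / (`|a| + 1) by rewrite !divr_gt0.
have e2 : 0 < e / 2 by rewrite divr_gt0.
have [n1 h1] := nx _ e1; have [n2 h2] := ny _ e2.
set n := maxn n1 n2.
exists n => G m tG nm; rewrite !pairing_lin.
have hx := tail_leW ax (leq_maxl n1 n2) h1 tG nm.
have hy := tail_leW ay (leq_maxr n1 n2) h2 tG nm.
have -> : a * pairing m x G + pairing m y G - (a * pairing n x G + pairing n y G) =
  a * (pairing m x G - pairing n x G) + (pairing m y G - pairing n y G) by lra.
apply: le_trans (ler_normD _ _) _; rewrite normrM [leRHS]splitr; apply: lerD => //.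
apply: le_trans (ler_wpM2l (normr_ge0 a) hx) _.
by rewrite mulrA ler_pdivrMr // mulrDr mulr1 mulrC lerDl ltW.
Qed.

HB.instance Definition _ := GRing.isSubmodClosed.Build _ _ tree_pred
  tree_submod_closed.

Record tree_space := TreeSpace { tval : seq bool -> R; _ : tval \in tree_pred }.

HB.instance Definition _ := [isSub for tval].
HB.instance Definition _ := [Choice of tree_space by <:].
HB.instance Definition _ := [SubChoice_isSubLmodule of tree_space by <:].

Implicit Types (f g : tree_space).

Lemma tval_lin a f g : tval (a *: f + g) = a *: tval f + tval g.
Proof. by []. Qed.

Lemma tval_additive f : additive (tval f).
Proof. by case: f => x /= /tree_predP[]. Qed.

Lemma tval_null_tail f : null_tail (tval f).
Proof. by case: f => x /= /tree_predP[]. Qed.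

Lemma pairing_linD n a f g G :
  pairing n (tval (a *: f + g)) G = a * pairing n (tval f) G + pairing n (tval g) G.
Proof. by rewrite tval_lin pairing_lin. Qed.

Definition tests f := [set pairing p.2 (tval f) p.1 | p in
  [set p : (seq bool -> R) * nat | unit_test k p.1]].

Definition tnorm f : R := sup (tests f).

Lemma level_bound n x : exists C, forall t, size t = n -> `|x t| <= C.
Proof.
elim: n x => [|n IHn] x; first by exists `|x [::]| => t /size0nil ->.
have [C0 h0] := IHn (child false x); have [C1 h1] := IHn (child true x).
exists (Num.max C0 C1) => -[|b t] // [tn]; rewrite le_max; apply/orP.
by case: b; [right; exact: h1 | left; exact: h0].
Qed.

Lemma unit_test0 : unit_test k (fun=> 0 : R).
Proof.
by split=> [|n]; [exact: martingale0 | rewrite pvar_const subrr epow0 ler01].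
Qed.

(** Beyond level [n] the null tail adds at most 1; up to level [n], tests bounded by 1 meet at most
    2^n bounded values. *)
Lemma tests_has_sup f : has_sup (tests f).
Proof.
split; first by exists (pairing 0 (tval f) (fun=> 0)), (fun=> 0, 0%N) => //=; exact: unit_test0.
have [n hn] := tval_null_tail f ltr01.
have [C hC] := level_bound n (tval f).
exists (1 + 2 ^+ n * C) => _ [[G m] /= tG <-].
have [nm|mn] := leqP n m.
  have := hn G m tG nm; have := ler_pairing (fun t => unit_test_le1 t tG) hC.
  by rewrite !ler_norml => /andP[_ h1] /andP[_ h2]; lra.
rewrite -(pairing_trunc G (tval_additive f) (ltnW mn)).
have := ler_pairing (fun t => unit_test_le1 t (unit_test_trunc m tG)) hC.
by rewrite ler_norml => /andP[_ h1]; lra.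
Qed.

Lemma ler_tnorm f G n : unit_test k G -> pairing n (tval f) G <= tnorm f.
Proof.
move=> tG; apply: ub_le_sup; first by case: (tests_has_sup f).
by exists (G, n).
Qed.

Lemma tnorm_le f c : (forall G n, unit_test k G -> pairing n (tval f) G <= c) ->
  tnorm f <= c.
Proof.
move=> h; apply: ge_sup; first by case: (tests_has_sup f).
by move=> _ [[G n] /= tG <-]; exact: h.
Qed.

Lemma normr_pairing_le f G n : unit_test k G -> `|pairing n (tval f) G| <= tnorm f.
Proof.
move=> tG; rewrite ler_norml ler_tnorm // andbT.
have := ler_tnorm f n (unit_testN tG); rewrite pairingZr; lra.
Qed.

Lemma tnormD f g : tnorm (f + g) <= tnorm f + tnorm g.
Proof.
apply: tnorm_le => G n tG; rewrite -[f]scale1r pairing_linD mul1r scale1r.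
by apply: lerD; exact: ler_tnorm.
Qed.

Lemma tnormZ_le (a : R) f : tnorm (a *: f) <= `|a| * tnorm f.
Proof.
apply: tnorm_le => G n tG; rewrite -[a *: f]addr0 pairing_linD pairing_0l addr0.
apply: le_trans (ler_norm _) _; rewrite normrM.
by apply: ler_wpM2l => //; exact: normr_pairing_le.
Qed.

Lemma tnormZ (a : R) f : tnorm (a *: f) = `|a| * tnorm f.
Proof.
apply/eqP; rewrite eq_le tnormZ_le /=.
have [->|a0] := eqVneq a 0.
  by rewrite normr0 mul0r scale0r; have := ler_tnorm 0 0 unit_test0; rewrite pairing_0l.
rewrite -ler_pdivlMl ?normr_gt0 //.
have := tnormZ_le a^-1 (a *: f); rewrite scalerA mulVf // scale1r.
by rewrite normfV.
Qed.

Lemma ler_tval f t : `|tval f t| <= 2 * tnorm f.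
Proof.
have := normr_pairing_le f (size t) (unit_test_node R k t).
rewrite pairingZr pairing_node_test // take_size subnn expr0 mulr1 normrM.
rewrite (ger0_norm (_ : 0 <= 2^-1)) ?invr_ge0 //; lra.
Qed.

Lemma tnorm_eq0 f : tnorm f = 0 -> f = 0.
Proof.
move=> f0; apply/val_inj/funext => t /=.
have := ler_tval f t; rewrite f0 mulr0 normr_le0 => /eqP ->.
by [].
Qed.

HB.instance Definition _ := Lmodule_isNormed.Build R tree_space
  tnormD tnormZ tnorm_eq0.

Lemma tnormE f : `|f| = tnorm f. Proof. by []. Qed.

End Space.

(** * Completeness *)

Section Completeness.
Variables (R : realType) (k : nat).
Local Notation X := (tree_space R k).

Lemma near_level (F : set_system X) (n : nat) (P : seq bool -> set X) :
  Filter F -> (forall t, F (P t)) -> F [set f | forall t, size t = n -> P t f].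
Proof.
move=> FF; elim: n P => [|n IHn] P FP.
  by apply: filterS (FP [::]) => f h t /size0nil ->.
have h0 := IHn (fun t => P (false :: t)) (fun t => FP _).
have h1 := IHn (fun t => P (true :: t)) (fun t => FP _).
apply: filterS2 h0 h1 => f h0 h1 [|[] t] //= [tn]; [exact: h1|exact: h0].
Qed.

Lemma pairing_dist n (x y : seq bool -> R) G d : unit_test k G ->
  (forall t, size t = n -> `|x t - y t| <= d) ->
  `|pairing n x G - pairing n y G| <= 2 ^+ n * d.
Proof.
move=> tG h; rewrite -[- pairing n y G]mulN1r -pairingZl -pairingDl.
apply: ler_pairing => [t|t tn]; first exact: unit_test_le1 tG.
by rewrite fctE mulN1r; exact: h.
Qed.

Lemma normr_pairing_dist (f g : X) n G : unit_test k G ->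
  `|pairing n (tval f) G - pairing n (tval g) G| <= `|f - g|.
Proof.
move=> tG; have -> : f - g = -1 *: g + f by rewrite scaleN1r addrC.
have := normr_pairing_le (-1 *: g + f) n tG.
by rewrite pairing_linD mulN1r addrC.
Qed.

(** The limit [L] is taken coordinatewise. Norm estimates pass to it level by level, as a pairing at
    level [n] involves finitely many nodes; their uniformity over tests gives [L] a null tail. *)
Lemma tree_space_complete (F : set_system X) : ProperFilter F -> cauchy F -> cvg F.
Proof.
move=> FF /cauchyP cF.
have FB e : 0 < e -> exists f : X, F [set g | `|f - g| <= e].
  move=> e0; have [f hf] := cF e e0; exists f; apply: filterS hf => g.
  by rewrite -ball_normE /= => /ltW.
have cvL t : cvg ((fun f : X => tval f t) @ F).
  apply: cauchy_cvg; apply/cauchyP => e e0.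
  have e4 : 0 < e / 4 by rewrite divr_gt0.
  have [f hf] := FB _ e4; exists (tval f t).
  change (F [set g : X | ball (tval f t) e (tval g t)]).
  apply: filterS hf => g /= fg; rewrite -ball_normE /=.
  have := ler_tval (f - g) t.
  change (tval (f - g) t) with (tval f t - tval g t).
  rewrite -tnormE; lra.
pose L t := lim ((fun f : X => tval f t) @ F).
have near_L t d : 0 < d -> F [set f : X | `|tval f t - L t| <= d].
  move=> d0; have /cvgrPdist_le/(_ d d0) := cvL t.
  by apply: filterS => f /=; rewrite distrC.
have near_Ln n d : 0 < d ->
    F [set f : X | forall t, size t = n -> `|tval f t - L t| <= d].
  by move=> d0; apply: near_level => t; exact: near_L.
have distL e f G n : 0 < e -> F [set g | `|f - g| <= e] -> unit_test k G ->
    `|pairing n (tval f) G - pairing n L G| <= e.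
  move=> e0 Ff tG; apply/ler_addgt0Pr => d d0.
  have d1 : 0 < d / 2 ^+ n by rewrite divr_gt0 // exprn_gt0.
  have [g [/= fg gL]] := filter_ex (filterI Ff (near_Ln n _ d1)).
  have := pairing_dist tG gL; rewrite mulrC divfK ?expf_neq0 // => h.
  apply: le_trans (ler_distD (pairing n (tval g) G) _ _) _.
  by apply: lerD => //; apply: le_trans (normr_pairing_dist f g n tG) fg.
have aL : additive L.
  move=> t; apply/eqP; rewrite -subr_eq0 -normr_le0; apply/ler_addgt0Pr => e e0.
  have e3 : 0 < e / 3 by rewrite divr_gt0.
  have [f [/= h1 [h2 h3]]] := filter_ex (filterI (near_L t _ e3)
    (filterI (near_L (rcons t false) _ e3) (near_L (rcons t true) _ e3))).
  have := tval_additive f t; move: h1 h2 h3; rewrite !ler_norml => *; lra.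
have nL : null_tail k L.
  move=> e e0; have e4 : 0 < e / 3 by rewrite divr_gt0.
  have [f hf] := FB _ e4; have [n hn] := tval_null_tail f e4.
  exists n => G m tG nm; have := hn G m tG nm.
  have := distL _ f G m e4 hf tG; have := distL _ f G n e4 hf tG.
  rewrite !ler_norml => *; lra.
have LX : L \in tree_pred k by apply/tree_predP.
apply/cvg_ex; exists (TreeSpace LX : X); apply/cvgrPdist_le => e e0.
have e2 : 0 < e / 2 by rewrite divr_gt0.
have [f hf] := FB _ e2; apply: filterS (hf) => g /= fg.
rewrite distrC.
have -> : g - TreeSpace LX = -1 *: (TreeSpace LX : X) + g by rewrite scaleN1r addrC.
apply: tnorm_le => G n tG; rewrite pairing_linD mulN1r.
have := distL _ f G n e2 hf tG; have := normr_pairing_dist f g n tG.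
rewrite !ler_norml => *; lra.
Qed.

HB.instance Definition _ := Uniform_isComplete.Build (tree_space R k)
  tree_space_complete.

End Completeness.

(** * Simple elements and their density *)

Section SimpleElements.
Variables (R : realType) (k : nat).
Implicit Types (G F x : seq bool -> R) (t s : seq bool).

(* Below level n the mass of x is spread uniformly. *)
Definition simple n x := forall t s, size t = n -> x (t ++ s) = x t * 2^-1 ^+ size s.

Definition uniform : seq bool -> R := fun t => 2^-1 ^+ size t.

Lemma additive_uniform : additive uniform.
Proof. by move=> t; rewrite /uniform !size_rcons exprSr; lra. Qed.

Lemma simple_uniform n : simple n uniform.
Proof. by move=> t s _; rewrite /uniform size_cat exprD. Qed.

Lemma pairing_simple n m x G : martingale G -> simple n x -> (n <= m)%N ->
  pairing m x G = pairing n x G.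
Proof.
elim: n m x G => [|n IHn] m x G mG sx.
  move=> _; have -> : x = fun t => x [::] * uniform t.
    by apply/funext => t; rewrite -(sx [::]).
  rewrite pairingZl /= -mulrA; congr (_ * _).
  rewrite /uniform /= expr0 mul1r -/uniform.
  elim: m G mG => [|m IHm] G mG /=; first by rewrite /uniform expr0 mul1r.
  have e b : child b uniform = fun t => 2^-1 * uniform t.
    by apply/funext => t; rewrite /child /uniform /= exprS.
  rewrite !e !pairingZl !IHm ?(mG [::]) /child /=; first by lra.
    exact: martingale_child.
  exact: martingale_child.
case: m => // m nm /=; congr +%R; apply: IHn => //;
  by [exact: martingale_child | move=> t s ht; apply: (sx (_ :: t)); rewrite /= ht].
Qed.

Lemma pairing_uniform n G : martingale G -> pairing n uniform G = G [::].
Proof.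
move=> mG; rewrite (pairing_simple mG (@simple_uniform 0)) //=.
by rewrite /uniform expr0 mul1r.
Qed.

Lemma simple_tree n x : additive x -> simple n x -> x \in tree_pred k.
Proof.
move=> ax sx; apply/tree_predP; split=> // e e0; exists n => G m [mG _] nm.
by rewrite (pairing_simple mG sx) // subrr normr0 ltW.
Qed.

Lemma simple_norm_le n (f : tree_space R k) c : simple n (tval f) ->
  (forall G, unit_test k G -> pairing n (tval f) G <= c) -> `|f| <= c.
Proof.
move=> sf h; apply: tnorm_le => G m tG; have [nm|mn] := leqP n m.
  by rewrite (pairing_simple _ sf) //; [exact: h | case: tG].
rewrite -(pairing_trunc G (tval_additive f) (ltnW mn)).
by apply: h; exact: unit_test_trunc.
Qed.

(** The normalized indicator h_t as an additive function: mass 1 along the path to [t], uniform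
    below [t]. *)
Fixpoint flow t : seq bool -> R :=
  if t is b :: t' then node_case 1 (fun c => if c == b then flow t' else fun=> 0)
  else uniform.

Lemma flow_root t : flow t [::] = 1.
Proof. by case: t => //=; rewrite /uniform expr0. Qed.

Lemma additive_flow t : additive (flow t).
Proof.
elim: t => [|b t IHt]; first exact: additive_uniform.
move=> [|c s] /=; last by case: ifP => _; rewrite ?addr0 // IHt.
by case: b => /=; rewrite flow_root ?addr0 ?add0r.
Qed.

Lemma simple_flow t : simple (size t) (flow t).
Proof.
elim: t => [|b t IHt]; first exact: simple_uniform.
move=> [|c s] r // [hs] /=; case: ifP => _; first exact: IHt.
by rewrite mul0r.
Qed.

Lemma flow_split t : flow t = 2^-1 *: (flow (rcons t false) + flow (rcons t true)).
Proof.
apply/funext => s.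
change (flow t s = 2^-1 * (flow (rcons t false) s + flow (rcons t true) s)).
elim: t s => [|b t IHt] [|c s] /=; rewrite /uniform ?expr0; try lra.
  by rewrite exprS; case: c => /=; lra.
by case: ifP => _; [rewrite IHt | lra].
Qed.

(** A simple [x] is the combination of the h_t of level [n] with weights x t, so a functional acts
    on it through its values on the h_t. *)
Lemma pairing_flow n x s : additive x -> simple n x ->
  pairing n x (fun t => flow t s) = x s.
Proof.
elim: n x s => [|n IHn] x s ax sx; first by rewrite /= (sx [::] s).
case: s => [|c s].
  rewrite (@pairing_eqr _ n.+1 x _ (fun=> 1)) ?pairing_const ?mul1r // => t _.
  exact: flow_root.
have sc b : simple n (child b x).
  by move=> t r ht; apply: (sx (b :: t)); rewrite /= ht.
have e b : pairing n (child b x) (child b (fun t => flow t (c :: s))) =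
    if c == b then x (c :: s) else 0.
  rewrite /child /=; case: eqP => [->|_]; last by rewrite pairing_0r.
  exact: (IHn (child b x) s (additive_child b ax) (sc b)).
by rewrite [LHS]/= !e; case: c {e}; rewrite /= ?addr0 ?add0r.
Qed.

Definition flow_vec t : tree_space R k :=
  TreeSpace (simple_tree (additive_flow t) (@simple_flow t)).

Fixpoint comb n x (e : seq bool -> tree_space R k) : tree_space R k :=
  if n is m.+1 then
    comb m (child false x) (fun t => e (false :: t)) +
    comb m (child true x) (fun t => e (true :: t))
  else x [::] *: e [::].

Lemma tval_comb n x e s : tval (comb n x e) s = pairing n x (fun t => tval (e t) s).
Proof.
elim: n x e => [|n IHn] x e //=.
change (tval (comb n (child false x) (fun t => e (false :: t))) s +
  tval (comb n (child true x) (fun t => e (true :: t))) s = 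
  pairing n (child false x) (fun t => tval (e (false :: t)) s) +
  pairing n (child true x) (fun t => tval (e (true :: t)) s)).
by rewrite !IHn.
Qed.

Lemma comb_flow n (f : tree_space R k) : simple n (tval f) ->
  comb n (tval f) flow_vec = f.
Proof.
move=> sf; apply/val_inj/funext => s /=; rewrite tval_comb pairing_flow //.
exact: tval_additive.
Qed.

(** The conditional expectation on level [n]. *)
Definition spread n x : seq bool -> R := fun t => x (take n t) * 2^-1 ^+ (size t - n).

Lemma spread_low n x t : (size t <= n)%N -> spread n x t = x t.
Proof.
by move=> tn; rewrite /spread take_oversize // (eqP tn) expr0 mulr1.
Qed.

Lemma additive_spread n x : additive x -> additive (spread n x).
Proof.
move=> ax t; case: (ltnP (size t) n) => h.
  by rewrite !spread_low ?size_rcons // ltnW.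
have e b : take n (rcons t b) = take n t by rewrite -cats1 takel_cat.
by rewrite /spread !e !size_rcons subSn // exprSr; lra.
Qed.

Lemma simple_spread n x : simple n (spread n x).
Proof.
move=> t s tn; rewrite [in RHS]spread_low ?tn // /spread take_size_cat //.
by rewrite size_cat tn addKn.
Qed.

Lemma pairing_eql n x y G : (forall t, size t = n -> x t = y t) ->
  pairing n x G = pairing n y G.
Proof.
elim: n x y G => [|n IHn] x y G h /=; first by rewrite h.
by congr +%R; apply: IHn => t ht; apply: h; rewrite /= ht.
Qed.

Lemma simple_dense (f : tree_space R k) (e : R) : 0 < e ->
  exists n (g : tree_space R k), simple n (tval g) /\ `|f - g| <= e.
Proof.
move=> e0; have [n hn] := tval_null_tail f e0.
have af := tval_additive f.
pose g := TreeSpace (simple_tree (additive_spread n af) (@simple_spread n (tval f))).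
have sg : simple n (tval g) by exact: simple_spread.
exists n, g; split=> //.
have -> : f - g = -1 *: g + f by rewrite scaleN1r addrC.
apply: tnorm_le => G m tG; rewrite pairing_linD mulN1r addrC.
have [nm|mn] := leqP n m.
  rewrite (pairing_simple _ sg) //; last by case: tG.
  rewrite (@pairing_eql n (tval g) (tval f)).
    by have := hn G m tG nm; rewrite ler_norml => /andP[].
  by move=> t tn; apply: spread_low; rewrite tn.
rewrite (@pairing_eql m (tval g) (tval f)) ?subrr ?ltW //.
by move=> t tm; apply: spread_low; rewrite tm ltnW.
Qed.

End SimpleElements.

(** * Norming atoms and their two prolongations *)

Section Splitting.
Variables (R : realType) (k : nat).
Implicit Types (G F x : seq bool -> R) (t s : seq bool).

Lemma pairing_branch n v b x y G :
  pairing n.+1 (node_case v (fun c => if c == b then x else y)) G =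
  pairing n x (child b G) + pairing n y (child (~~ b) G).
Proof. by case: b; rewrite //= addrC. Qed.

(* The atom norming F along an optimal family of segments has two variants,
   a false and a true, in which every segment is prolonged to the left,
   respectively to the right; g tells them apart.  The number w is the mass of
   the segment that is still open at the root. *)
Lemma split_atom n F u : martingale F ->
  exists w (a : bool -> seq bool -> R) g,
  [/\ forall j, additive (a j) /\ simple n.+1 (a j),
      forall G v j, martingale G -> (k.+1).*2%:R * (pairing n.+1 (a j) G - w * v) <=
        (k.*2.+1)%:R * pvar k n F u + pvar k n.+1 G v,
      pairing n.+1 (a false) F + pairing n.+1 (a true) F - 2 * (w * u) =
        2 * pvar k n F u,
      martingale g /\ g [::] = 0
    & (forall m, pvar k m g 0 <= 2 * pvar k n F u) /\
      pairing n.+1 (a false) g - pairing n.+1 (a true) g = 2 * pvar k n F u].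
Proof.
elim: n F u => [|n IHn] F u mF.
  (* The weight D^(p-1) is the equality case of Young's inequality. *)
  set D := F [::] - u; set E := epow_deriv k D.
  pose a j : seq bool -> R := node_case E (fun c => if c == j then
    (fun t => E * uniform R t) else fun=> 0).
  have ED : E * D = epow k D by exact: epow_deriv_mul.
  have pa j G : pairing 1 (a j) G = E * G [:: j].
    by rewrite /= /child; case: j; rewrite /= /uniform expr0 mulr1 mul0r ?addr0 ?add0r.
  exists E, a, (fork true D); split.
  - move=> j; split.
      move=> [|c t] /=; first by case: j; rewrite /uniform /= ?expr0 ?mulr1 ?addr0 ?add0r.
      by case: ifP => _; rewrite ?addr0 // additive_uniform mulrDr.
    move=> [|c [|d t]] s // _ /=; case: ifP => _; last by rewrite mul0r.
    by rewrite /uniform /= ?expr0 ?mulr1.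
  - move=> G v j mG; rewrite pa -mulrBr; apply: le_trans (young _ _ _) _.
    rewrite lerD2l; apply: le_trans (pvarS_ge k j 0 G v).
    by rewrite lerDl epow_ge0.
  - rewrite !pa; have := mF [::] => /= mF0; rewrite -ED /D mF0; lra.
  - by split=> //; exact: martingale_fork.
  - split=> [m|]; last by rewrite !pa /fork /= -ED -/D; lra.
    case: m => [|m]; first by rewrite /= subrr epow0 mulr_ge0 ?epow_ge0.
    rewrite pvarS0 // !child_fork !pvar_const /= !subr0 epowN -/D; lra.
have [b eb] := pvarS_ex k n F u.
have [w [a [g [ha1 ha2 ha3 [mg g0] [ha4 ha5]]]]] :=
  IHn (child b F) u (martingale_child b mF).
have [w' [a' [g' [hb1 hb2 hb3 [mg' g'0] [hb4 hb5]]]]] :=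
  IHn (child (~~ b) F) (F [::]) (martingale_child (~~ b) mF).
pose A j : seq bool -> R := node_case (a j [::] + a' j [::])
  (fun c => if c == b then a j else a' j).
(* The segment entering the other child starts at the root. Its start term [w' * G [::]] is a
   pairing with a multiple of [uniform], by [pairing_uniform], hence the subtraction. *)
pose h : bool -> seq bool -> R := fun j t => A j t - w' * uniform R t.
pose q := node_case 0 (fun c => if c == b then g else g').
have ph j G : martingale G -> pairing n.+2 (h j) G =
    pairing n.+1 (a j) (child b G) + pairing n.+1 (a' j) (child (~~ b) G) -
    w' * G [::].
  move=> mG; have -> : h j = A j + (fun t => (- w') * uniform R t).
    by apply/funext => t; rewrite /h fctE mulNr.
  by rewrite pairingDl pairingZl pairing_uniform // mulNr pairing_branch.
have qb : child b q = g by rewrite /child /q /= eqxx.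
have qb' : child (~~ b) q = g' by rewrite /child /q /=; case: (b).
have mq : martingale q.
  by apply: martingale_node_case => c; case: ifP.
exists w, h, q; split.
- move=> j; have [aa sa] := ha1 j; have [aa' sa'] := hb1 j; split.
    move=> t; rewrite /h additive_uniform.
    suff -> : A j t = A j (rcons t false) + A j (rcons t true) by lra.
    case: t => [|c t] /=; last by case: ifP => _; [exact: aa | exact: aa'].
    by case: (b); rewrite //= addrC.
  move=> t s tn; rewrite /h (@simple_uniform R n.+2 t s tn) mulrBl mulrA; congr (_ - _).
  case: t tn => [|c t] //= [tn]; case: ifP => _; [exact: sa | exact: sa'].
- move=> G v j mG; rewrite ph //.
  have h1 := ha2 (child b G) v j (martingale_child b mG).
  have h2 := hb2 (child (~~ b) G) (G [::]) j (martingale_child (~~ b) mG).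
  have h3 := pvarS_ge k b n.+1 G v; rewrite eb.
  have -> : pairing n.+1 (a j) (child b G) + pairing n.+1 (a' j) (child (~~ b) G) -
     w' * G [::] - w * v = (pairing n.+1 (a j) (child b G) - w * v) +
     (pairing n.+1 (a' j) (child (~~ b) G) - w' * G [::]) by lra.
  rewrite mulrDr mulrDr; lra.
- rewrite !ph //; move: ha3 hb3; rewrite eb; lra.
- by split.
- split=> [m|].
    have := pvar_ge0 k n.+1 F u.
    case: m => [|m]; first by rewrite [X in _ -> X <= _]/= subrr epow0; lra.
    move=> _;
    rewrite eb; have := ha4 m; have := hb4 m.
    have -> : pvar k m.+1 q 0 = pvar k m g 0 + pvar k m g' 0.
      by rewrite pvarS0 // -qb -qb'; case: (b); rewrite // addrC.
    lra.
  rewrite !ph // qb qb' eb; lra.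
Qed.

End Splitting.

(** * Functionals of norm one and diameters *)

Section Duals.
Variables (R : realType) (X : normedModType R).
Implicit Types (f : dual X) (x y : X).

Lemma dual_lin f a x y : f (a *: x + y) = a * f x + f y.
Proof. by rewrite /dual_fun linearP. Qed.

Lemma dual_add f x y : f (x + y) = f x + f y.
Proof. by rewrite -[x]scale1r dual_lin mul1r scale1r. Qed.

Lemma dual_scale f a x : f (a *: x) = a * f x.
Proof. by rewrite /dual_fun linearZ. Qed.

Lemma dual_norm1_le f x : dual_unit_sphere X f -> `|f x| <= `|x|.
Proof.
move=> f1; have [->|x0] := eqVneq x 0.
  by rewrite -[0 : X](scale0r 0) dual_scale mul0r !normr0.
have nx : 0 < `|x| by rewrite normr_gt0.
have : ((`|f (`|x|^-1 *: x)|)%:E <= dual_norm f)%E.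
  apply: ereal_sup_ubound; exists (`|x|^-1 *: x) => //=.
  by rewrite /closed_unit_ball /= normrZ normfV normr_id mulVf // gt_eqF.
rewrite (f1 : dual_norm f = _) lee_fin dual_scale normrM normfV normr_id.
by rewrite ler_pdivrMl // mulr1.
Qed.

Lemma dual_norm1_contra f c : dual_unit_sphere X f -> c < 1 ->
  ~ forall x, `|f x| <= c * `|x|.
Proof.
move=> f1 c1 h.
have c0 : 0 <= Num.max c 0 by rewrite le_max lexx orbT.
have : (dual_norm f <= (Num.max c 0)%:E)%E.
  apply: ge_ereal_sup => _ [x /= x1 <-]; rewrite lee_fin.
  apply: le_trans (h x) _; apply: (@le_trans _ _ (Num.max c 0 * `|x|)).
    by apply: ler_wpM2r => //; rewrite le_max lexx.
  by have := ler_wpM2l c0 x1; rewrite mulr1.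
rewrite (f1 : dual_norm f = _) lee_fin le_max => /orP[]; lra.
Qed.

Lemma diameter_ge (A : set X) x y : A x -> A y ->
  ((`|x - y|)%:E <= diameter A)%E.
Proof. by move=> Ax Ay; apply: ereal_sup_ubound; exists (x, y). Qed.

End Duals.

(** * Diameter of slices *)

Section Slices.
Variables (R : realType) (k : nat).
Local Notation X := (tree_space R k).
Implicit Types (f : dual X).

(** The martingale representing [f] through the pairing. *)
Definition flow_fun f : seq bool -> R := fun t => f (flow_vec R k t).

Lemma martingale_flow_fun f : martingale (flow_fun f).
Proof.
move=> t; rewrite /flow_fun.
have -> : flow_vec R k t = 2^-1 *: (flow_vec R k (rcons t false) + flow_vec R k (rcons t true)).
  by apply/val_inj; exact: flow_split.
by rewrite dual_scale dual_add mulrC.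
Qed.

Lemma dual_comb f n x e : f (comb n x e) = pairing n x (fun t => f (e t)).
Proof.
elim: n x e => [|n IHn] x e; first exact: dual_scale.
by rewrite [LHS]dual_add !IHn.
Qed.

Lemma dual_simple f n (x : X) : simple n (tval x) ->
  f x = pairing n (tval x) (flow_fun f).
Proof. by move=> sx; rewrite -[in LHS](comb_flow sx) dual_comb. Qed.

Section SliceDiameter.
Variable f : dual X.
Hypothesis f1 : dual_unit_sphere X f.

(** Otherwise [c^-1 * flow_fun f] is a unit test, so |f| is at most [c] times the norm on simple
    elements, by density everywhere, against norm 1. *)
Lemma pvar_flow_gt c : 0 < c -> c < 1 -> exists n, epow k c < pvar k n (flow_fun f) 0.
Proof.
move=> c0 c1; apply/not_existsP => h.
have tF : unit_test k (fun t => c^-1 * flow_fun f t).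
  apply: unit_testZ => [|n]; first exact: martingale_flow_fun.
  have -> : 1 = epow k c^-1 * epow k c by rewrite -epowM mulVf ?epow1 // gt_eqF.
  apply: ler_wpM2l; first exact: epow_ge0.
  by rewrite leNgt; apply/negP; exact: h.
have hs n (x : X) : simple n (tval x) -> `|f x| <= c * `|x|.
  move=> sx; rewrite (dual_simple _ sx).
  have := normr_pairing_le x n tF; rewrite pairingZr normrM normfV (gtr0_norm c0).
  by rewrite ler_pdivrMl.
apply: (dual_norm1_contra f1 c1) => x; apply/ler_addgt0Pr => e e0.
have e2 : 0 < e / 2 by rewrite divr_gt0.
have [n [y [sy xy]]] := simple_dense x e2.
have -> : x = (x - y) + y by rewrite subrK.
rewrite dual_add; apply: le_trans (ler_normD _ _) _.
have h1 := dual_norm1_le (x - y) f1; have h2 := hs n y sy.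
have h3 : `|y| <= `|x| + e / 2.
  by have := ler_normB x (x - y); rewrite subKr; lra.
have h4 := ler_wpM2l (ltW c0) h3; rewrite subrK.
have : c * (e / 2) <= 1 * (e / 2) by apply: ler_wpM2r; lra.
lra.
Qed.

(** The two prolongations of an almost norming atom both lie in the slice. As lam^p <= 1/2 and [g]
    has variation at most 2, lam g is a unit test, and it separates them by 2 lam N with N > M. *)
Lemma slice_diameter (alpha lam : R) :
  0 < alpha -> 0 < lam -> epow k lam <= 2^-1 -> forall M : R, 0 <= M -> M < 1 ->
  ((2 * lam * M)%:E <= diameter (slice f alpha))%E.
Proof.
move=> al0 l0 l2 M M0 M1.
pose p : R := (k.+1).*2%:R; have p0 : 0 < p by rewrite ltr0n.
have pp : (k.*2.+1)%:R = p - 1 by rewrite /p doubleS -[k.*2.+2]addn1 natrD addrK.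
pose m := Num.max M (1 - alpha / 2).
have m1 : m < 1 by rewrite gt_max M1; lra.
have m0 : 0 <= m by rewrite le_max M0.
(* Bernoulli's inequality: c = 1 - (1 - m) / p has c^p >= m. *)
have [c [c0 c1 mc]] : exists c, [/\ 0 < c, c < 1 & m <= epow k c].
  have bern n (a : R) : 0 <= a -> a <= 1 -> 1 - n%:R * a <= (1 - a) ^+ n.
    move=> a0 a1; elim: n => [|n IHn]; first by rewrite expr0; lra.
    rewrite exprS; have a2 : 0 <= 1 - a by lra.
    apply: le_trans (ler_wpM2l a2 IHn).
    have : 0 <= n%:R * a * a by rewrite !mulr_ge0.
    by rewrite -[n.+1]addn1 natrD; lra.
  have p2 : 2 <= p by rewrite /p ler_nat doubleS.
  have q0 : 0 < (1 - m) / p by rewrite divr_gt0 //; lra.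
  have q1 : (1 - m) / p < 1 by rewrite ltr_pdivrMr //; lra.
  exists (1 - (1 - m) / p); split; [lra | lra |].
  apply: le_trans (bern _ _ (ltW q0) (ltW q1)).
  by rewrite -/p mulrC divfK ?gt_eqF //; lra.
have [n hn] := pvar_flow_gt c0 c1.
set F := flow_fun f in hn.
have mF : martingale F by exact: martingale_flow_fun.
have [w [a [g [ha1 ha2 ha3 [mg g0] [ha4 ha5]]]]] := split_atom k n 0 mF.
set N := pvar k n F 0 in hn ha2 ha3 ha4 ha5.
pose x j : X := TreeSpace (simple_tree k (ha1 j).1 (ha1 j).2).
have sx j : simple n.+1 (tval (x j)) by exact: (ha1 j).2.
have xN j : p * `|x j| <= (p - 1) * N + 1.
  rewrite -ler_pdivlMl //; apply: (simple_norm_le (sx j)) => G [mG G1].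
  rewrite ler_pdivlMl //; have := ha2 G 0 j mG; rewrite mulr0 subr0 pp.
  by move=> /le_trans; apply; rewrite lerD2l.
have fx j : f (x j) = pairing n.+1 (a j) F by exact: dual_simple.
have fsum : f (x false) + f (x true) = 2 * N by rewrite !fx; lra.
have fle j : f (x j) <= `|x j|.
  by apply: le_trans (ler_norm _) _; exact: dual_norm1_le.
(* Summing over both points, 2 N <= 2 ((p - 1) N + 1) / p. *)
have N1 : N <= 1.
  have h1 := fle false; have h2 := fle true.
  have : p * (2 * N) <= p * (`|x false| + `|x true|) by apply: ler_wpM2l; lra.
  have := xN false; have := xN true; rewrite mulrDr => *; lra.
have x1 j : `|x j| <= 1.
  have : (p - 1) * N <= (p - 1) * 1.
    by apply: ler_wpM2l => //; rewrite -pp ler0n.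
  have := xN j => h1 h2; rewrite -(ler_pM2l p0); lra.
have hm : m < N by exact: le_lt_trans hn.
have Nal : 1 - alpha / 2 < N by apply: le_lt_trans hm; rewrite le_max lexx orbT.
have NM : M < N by apply: le_lt_trans hm; rewrite le_max lexx.
(* The two values of [f] add up to 2 N > 2 - alpha and neither exceeds 1, so both exceed 1 -
   alpha. *)
have xs j : slice f alpha (x j).
  split; first exact: x1.
  have h1 := fle false; have h2 := fle true; have := x1 false; have := x1 true.
  by rewrite /=; case: j; lra.
apply: le_trans (diameter_ge (xs false) (xs true)); rewrite lee_fin.
have tg : unit_test k (fun t => lam * g t).
  apply: unit_testZ => // q; have := ha4 q => h.
  have h2 : pvar k q g 0 <= 2 by lra.
  apply: le_trans (ler_pM (epow_ge0 _ _) (pvar_ge0 _ _ _ _) l2 h2) _; lra.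
have := normr_pairing_dist (x false) (x true) n.+1 tg.
have tx j : tval (x j) = a j by [].
rewrite !tx !pairingZr -mulrBr ha5 => /(le_trans (ler_norm _)); apply: le_trans.
by rewrite -mulrA mulrCA; apply: ler_wpM2l; [exact: ltW | apply: ler_wpM2l; lra].
Qed.

End SliceDiameter.
End Slices.

(** * Weakly open sets *)

Section WeakTopology.
Variables (R : realType) (X : normedModType R).

Lemma weakly_open_preimage (f : dual X) (A : set R^o) : open A ->
  @open (weak_space X) (f @^-1` A).
Proof.
move=> oA; rewrite openE => x Ax.
have := (@cvg_sup X (dual X) (fun f : dual X =>
    Topological.on (initial_topology (f : X -> R^o))) (nbhs (x : weak_space X)) x
    (nbhs_filter (x : weak_space X))).1.
move=> /(_ cvg_id f); apply.
apply: open_nbhs_nbhs; split => //.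
by exists A.
Qed.

Lemma open_level (W : topologicalType) n (P : seq bool -> set W) :
  (forall t, open (P t)) -> open [set w | forall t, (size t <= n)%N -> P t w].
Proof.
elim: n P => [|n IHn] P oP.
  rewrite (_ : [set w | _] = P [::]) //; apply/seteqP; split=> w /=; first exact.
  by move=> h t; rewrite leqn0 => /nilP ->.
rewrite (_ : [set w | _] = P [::] `&`
  ([set w | forall t, (size t <= n)%N -> P (false :: t) w] `&`
   [set w | forall t, (size t <= n)%N -> P (true :: t) w])).
  by apply: openI => //; apply: openI; apply: IHn => t.
apply/seteqP; split=> w /=.
  by move=> h; split; [exact: h | split=> t tn; exact: h].
by move=> [h [h0 h1]] [|[] t] tn //; [exact: h1 | exact: h0].
Qed.

End WeakTopology.

(** * Coordinate functionals and weak boxes *)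

Section Coordinates.
Variables (R : realType) (k : nat).
Local Notation X := (tree_space R k).

Definition coord t (x : X) : R^o := tval x t.

Lemma coord_linear t : linear (coord t).
Proof. by []. Qed.

HB.instance Definition _ t := GRing.isLinear.Build R X R^o _ (coord t)
  (coord_linear t).

Lemma coord_continuous t : continuous (coord t).
Proof.
move=> x; apply/(@cvgrPdist_le _ _ _ _ (nbhs_filter x)) => e e0.
have e2 : 0 < e / 2 by rewrite divr_gt0.
have hb : nbhs x (ball x (e / 2)) by exact: nbhsx_ballx.
apply: (@filterS X (nbhs x) (nbhs_filter x) _ _ _ hb) => y.
rewrite -ball_normE /= => xy.
have := ler_tval (x - y) t; rewrite -tnormE.
change (tval (x - y) t) with (coord t x - coord t y); lra.
Qed.

Definition coord_dual t : dual X :=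
  exist (fun f : {linear X -> R^o} => continuous f) (coord t : {linear X -> R^o}) (@coord_continuous t).

Lemma weakly_open_box n (x : X) (d : R) :
  weakly_open [set y : X | forall t, (size t <= n)%N -> `|tval y t - tval x t| < d].
Proof.
apply: (@open_level (weak_space X) n (fun t => [set y : X | `|tval y t - tval x t| < d])) => t.
rewrite (_ : [set y : X | _] = coord_dual t @^-1` (ball (tval x t : R^o) d)).
  by apply: weakly_open_preimage; exact: ball_open.
by apply/seteqP; split=> y /=; rewrite -ball_normE /= distrC.
Qed.

(** Tested on halved cylinder indicators, [x] is beyond some level [q] within e / 2 of its uniform
    spreading, whose mass halves at each further level. *)
Lemma tval_small (x : X) (e : R) n : 0 < e ->
  exists2 l, (n <= l)%N & forall t, size t = l -> `|tval x t| <= e.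
Proof.
move=> e0; have e4 : 0 < e / 4 by rewrite divr_gt0.
have [q hq] := tval_null_tail x e4.
have [C hC] := level_bound q (tval x).
have [j hj] : exists j, C * 2^-1 ^+ j <= e / 2.
  exists (Num.truncn (C / (e / 2))).+1; set j := (Num.truncn _).+1.
  rewrite exprVn ler_pdivrMr ?exprn_gt0 // [leRHS]mulrC -ler_pdivrMr; last by lra.
  apply: le_trans (ltW (truncnS_gt _)) _; rewrite -/j.
  by rewrite -natrX ler_nat ltnW // ltn_expl.
exists (q + (n + j))%N => [|t tl]; first by lia.
have tq : (q <= size t)%N by rewrite tl leq_addr.
have := hq _ (size t) (unit_test_node R k t) tq.
rewrite !pairingZr !pairing_node_test // take_size subnn expr0 mulr1 -mulrBr.
rewrite normrM (ger0_norm (_ : 0 <= 2^-1)) ?invr_ge0 // => h.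
have h1 := hC (take q t); rewrite size_takel // in h1.
have h2 : `|tval x (take q t) * 2^-1 ^+ (size t - q)| <= e / 2.
  apply: le_trans hj; rewrite normrM; have C0 := le_trans (normr_ge0 _) (h1 erefl).
  apply: ler_pM => //; first exact: h1.
  rewrite ger0_norm ?exprn_ge0 ?invr_ge0 // tl addKn exprD ler_piMl ?exprn_ge0 ?invr_ge0 //.
  by rewrite exprn_ile1 ?invr_ge0 // invf_le1 ?ler1n.
have := ler_normD (tval x t - tval x (take q t) * 2^-1 ^+ (size t - q))
  (tval x (take q t) * 2^-1 ^+ (size t - q)).
rewrite subrK; lra.
Qed.

End Coordinates.

(** * Large weak neighbourhoods produce the forbidden [z] *)

Section Continuity.
Variables (R : realType) (k : nat).
Local Notation X := (tree_space R k).
Variables (C : set X) (eta : R).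
Hypothesis C_ball : C `<=` closed_unit_ball X.
Hypothesis eta_gt0 : 0 < eta.
Hypothesis C_large : forall V : set X, relatively_weakly_open C V -> V !=set0 ->
  ~ (diameter V < eta%:E)%E.

(** Otherwise the points of [C] in a weak box around [x] pair to at most eta / 8 with late tests,
    while the size of the box makes pairings up to level [n] agree within eta / 8; their distances
    stay below eta / 2. *)
Lemma far_point (x : X) n (d : R) : C x -> 0 < d -> exists y G m,
  [/\ C y, forall t, (size t <= n)%N -> `|tval y t - tval x t| <= d,
      unit_test k G, vanishes n G & eta / 8 < pairing m (tval y) G].
Proof.
move=> Cx d0; have eta0 : 0 < eta := eta_gt0.
pose d' := Num.min d (eta / 16 / 2 ^+ n).
have d'0 : 0 < d' by rewrite lt_min d0 !divr_gt0 ?exprn_gt0.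
have d'n : 2 ^+ n * d' <= eta / 16.
  rewrite mulrC -ler_pdivlMr ?exprn_gt0 // ge_min lexx orbT //.
pose U := [set y : X | forall t, (size t <= n)%N -> `|tval y t - tval x t| < d'].
apply: contrapT => h.
apply: (C_large (V := C `&` U)).
- by exists U => //; exact: weakly_open_box.
- by exists x; split=> // t _; rewrite subrr normr0.
have tails y : (C `&` U) y -> forall G m, unit_test k G -> vanishes n G ->
    `|pairing m (tval y) G| <= eta / 8.
  move=> [Cy Uy].
  have one G m : unit_test k G -> vanishes n G -> pairing m (tval y) G <= eta / 8.
    move=> tG vG; rewrite leNgt; apply/negP => hG; apply: h; exists y, G, m; split=> //.
    by move=> t tn; apply: le_trans (ltW (Uy t tn)) _; rewrite ge_min lexx.
  move=> G m tG vG; rewrite ler_norml one // andbT.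
  have := one _ m (unit_testN tG); rewrite pairingZr => h1.
  suff : vanishes n (fun t => -1 * G t) by move=> /h1; lra.
  by move=> t /vG ->; rewrite mulr0.
apply: (@le_lt_trans _ _ (eta / 2)%:E); last by rewrite lte_fin; lra.
apply: ge_ereal_sup => _ [[y y'] /= [hy hy'] <-]; rewrite lee_fin.
have low G m : unit_test k G -> (m <= n)%N ->
    `|pairing m (tval y) G - pairing m (tval y') G| <= eta / 8.
  move=> tG mn; apply: (@le_trans _ _ (2 ^+ m * (2 * d'))).
    apply: pairing_dist tG _ => t tm.
    have h1 := hy.2 t; have h2 := hy'.2 t; rewrite tm mn in h1 h2.
    apply: le_trans (ler_distD (tval x t) _ _) _; rewrite (distrC (tval x t)).
    by have := h1 isT; have := h2 isT; lra.
  have : 2 ^+ m <= 2 ^+ n :> R by rewrite ler_weXn2l // ler1n.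
  move=> /(ler_wpM2r (ltW d'0)); lra.
have -> : y - y' = -1 *: y' + y by rewrite scaleN1r addrC.
apply: tnorm_le => G m tG; rewrite pairing_linD mulN1r addrC.
have [mn|nm] := leqP m n.
  have := low G m tG mn; rewrite ler_norml => /andP[_ h1]; lra.
have tT := unit_test_tail n tG.
have vT : vanishes n (tail n G).
  by move=> t tn; rewrite /tail take_oversize ?subrr.
have := tails y hy _ m tT vT; have := tails y' hy' _ m tT vT.
rewrite !pairing_tail; try exact: ltnW; try exact: tval_additive.
have := low G n tG (leqnn n).
rewrite !ler_norml => *; lra.
Qed.

Record game_state := GameState { center : X; level : nat; radius : R;
  center_in : C center; radius_gt0 : 0 < radius }.

Definition in_box (s : game_state) (y : seq bool -> R) :=
  forall t, (size t <= level s)%N -> `|y t - tval (center s) t| <= radius s.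

(** The requirements bear on every tree function in the box, so that they pass to the limit [z],
    which is not known to lie in the space. *)
Definition game_step (s s' : game_state) :=
  [/\ (level s < level s')%N, radius s' <= radius s / 2,
      forall y, in_box s' y -> in_box s y,
      forall y, in_box s' y -> exists G m,
        [/\ unit_test k G, vanishes (level s) G & eta / 16 <= pairing m y G]
    & forall y, in_box s' y ->
        exists2 l, (level s <= l)%N & forall t, size t = l -> `|y t| <= radius s].

Lemma game_next s : exists s', game_step s s'.
Proof.
case: s => x n d Cx d0; have eta0 : 0 < eta := eta_gt0.
have d2 : 0 < d / 2 by rewrite divr_gt0.
have [x' [G [m [Cx' xx' tG vG hG]]]] := far_point n Cx d2.
have [l nl hl] := tval_small x' n d2.
pose n' := maxn n.+1 (maxn m l).
have [nn' mn' ln'] : [/\ (n < n')%N, (m <= n')%N & (l <= n')%N] by rewrite /n'; split; lia.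
pose d' := Num.min (d / 2) (eta / 16 / 2 ^+ m).
have d'0 : 0 < d' by rewrite lt_min d2 !divr_gt0 ?exprn_gt0.
have d'd : d' <= d / 2 by rewrite ge_min lexx.
exists (GameState n' Cx' d'0); split => //= y hy.
- move=> t tn; have := xx' t tn; have := hy t (leq_trans tn (ltnW nn')).
  move=> /= h1 h2; apply: le_trans (ler_distD (tval x' t) _ _) _; rewrite /=; lra.
- exists G, m; split=> //.
  have : `|pairing m y G - pairing m (tval x') G| <= 2 ^+ m * d'.
    by apply: pairing_dist tG _ => t tm; apply: hy; rewrite tm.
  have : 2 ^+ m * d' <= eta / 16.
    by rewrite mulrC -ler_pdivlMr ?exprn_gt0 // ge_min lexx orbT.
  rewrite ler_norml => h1 /andP[h2 _]; lra.
- exists l => // t tl; have := hl t tl; have := hy t; rewrite tl /= => /(_ ln') h1 h2.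
  by have := ler_normD (y t - tval x' t) (tval x' t); rewrite subrK; lra.
Qed.

Lemma large_false : C !=set0 -> False.
Proof.
move=> [x0 Cx0]; have eta0 : 0 < eta := eta_gt0.
have [nxt nxtP] := choice game_next.
pose s n := iter n nxt (GameState 0 Cx0 ltr01).
have sS n : game_step (s n) (s n.+1) by exact: nxtP.
have lev n : (n <= level (s n))%N.
  by elim: n => // n IHn; have [h _ _ _ _] := sS n; exact: leq_ltn_trans h.
have rad n : radius (s n) <= 2^-1 ^+ n.
  elim: n => [|n IHn]; first by rewrite expr0.
  by have [_ h _ _ _] := sS n; rewrite exprSr; lra.
have rad0 n : 0 < radius (s n) by exact: radius_gt0.
have rad_small (e : R) N : 0 < e -> exists2 n, (N <= n)%N & radius (s n) <= e.
  move=> e0; pose j := (Num.truncn e^-1).+1; exists (N + j)%N; first exact: leq_addr.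
  apply: le_trans (rad _) _; rewrite exprVn -(invrK e) lef_pV2 ?posrE ?exprn_gt0 ?invr_gt0 //.
  apply: le_trans (ltW (truncnS_gt _)) _; rewrite -/j -natrX ler_nat.
  by apply: (leq_trans (leq_addl N j)); apply: ltnW; exact: ltn_expl.
have box_mono n d y : in_box (s (n + d)%N) y -> in_box (s n) y.
  elim: d => [|d IHd]; first by rewrite addn0.
  by rewrite addnS => h; apply: IHd; have [_ _ + _ _] := sS (n + d)%N; apply.
have box_center n m : (n <= m)%N -> in_box (s n) (tval (center (s m))).
  move=> /subnKC <-; apply: (box_mono _ (m - n)%N) => t _.
  by rewrite subrr normr0 ltW.
(* [z t] is the common point of the nested intervals of the coordinate [t]. Only stages n >= size t
   enter, whose boxes reach [t] because level (s n) >= n. *)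
pose lows t := [set tval (center (s n)) t - radius (s n) | n in [set n | (size t <= n)%N]].
pose z t := sup (lows t).
have lows_le t n : (size t <= n)%N ->
    ubound (lows t) (tval (center (s n)) t + radius (s n)).
  move=> tn _ [m /= tm <-]; have [nm|mn] := leqP n m.
    have := box_center _ _ nm t (leq_trans tn (lev n)); rewrite ler_norml => /andP[_ h].
    by have := rad0 m; lra.
  have := box_center _ _ (ltnW mn) t (leq_trans tm (lev m)); rewrite ler_norml => /andP[h _].
  by have := rad0 n; lra.
have zb n t : (size t <= n)%N -> `|z t - tval (center (s n)) t| <= radius (s n).
  move=> tn; rewrite ler_norml; apply/andP; split.
    rewrite lerBrDl; apply: ub_le_sup; first by exists (tval (center (s n)) t + radius (s n)); exact: lows_le.
    by exists n.
  rewrite lerBlDl; apply: ge_sup; first by exists (tval (center (s n)) t - radius (s n)); exists n.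
  exact: lows_le.
have zbox n : in_box (s n) z.
  move=> t tn; apply/ler_addgt0Pr => e e0.
  have [m hm rm] := rad_small e (maxn n (size t)) e0; rewrite geq_max in hm.
  have /andP[nm tm] := hm.
  have h1 := zb m t tm; have h2 := box_center _ _ nm t tn.
  apply: le_trans (ler_distD (tval (center (s m)) t) _ _) _; lra.
have az : additive z.
  move=> t; apply/eqP; rewrite -subr_eq0 -normr_le0; apply/ler_addgt0Pr => e e0.
  have e3 : 0 < e / 3 by rewrite divr_gt0.
  have [n tn rn] := rad_small _ (size t).+1 e3.
  have h1 := zb n t (ltnW tn).
  have h2 := zb n (rcons t false); have h3 := zb n (rcons t true).
  rewrite !size_rcons in h2 h3; have {}h2 := h2 tn; have {}h3 := h3 tn.
  have := tval_additive (center (s n)) t; move: h1 h2 h3.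
  rewrite !ler_norml => *; lra.
have z1 G n : unit_test k G -> pairing n z G <= 1.
  move=> tG; apply/ler_addgt0Pr => e e0.
  have en : 0 < e / 2 ^+ n by rewrite divr_gt0 ?exprn_gt0.
  have [m nm rm] := rad_small _ n en.
  have h1 : `|pairing n z G - pairing n (tval (center (s m))) G| <= 2 ^+ n * radius (s m).
    by apply: pairing_dist tG _ => t tn; apply: zb; rewrite tn.
  have h2 : 2 ^+ n * radius (s m) <= e by rewrite mulrC -ler_pdivlMr ?exprn_gt0.
  have h3 := ler_tnorm (center (s m)) n tG.
  have h4 : `|center (s m)| <= 1 by apply: C_ball; exact: center_in.
  rewrite tnormE in h4; move: h1; rewrite ler_norml => /andP[_ h1]; lra.
(* Half of the eta / 16 kept by the boxes, as [has_tail] asks for a strict inequality. *)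
apply: (@no_tail R k z (eta / 32) az z1).
- move=> e n e0; have [m nm rm] := rad_small _ n e0.
  have [_ _ _ _ /(_ z (zbox m.+1))[l ml hl]] := sS m.
  exists l; first exact: leq_trans nm (leq_trans (lev m) ml).
  by move=> t tl; apply: le_trans (hl t tl) rm.
- by rewrite divr_gt0.
- move=> n; have [_ _ _ /(_ z (zbox n.+1))[G [m [tG vG hG]]] _] := sS n.
  exists G, m; split=> //; last by lra.
  by move=> t tn; apply: vG; exact: leq_trans tn (lev n).
Qed.

End Continuity.

(** * The CPCP and the choice of the exponent *)

Lemma tree_space_CPCP (R : realType) k : CPCP (tree_space R k).
Proof.
move=> C C1 C0 _ _ _ eta eta0; apply: contrapT => h.
apply: (large_false C1 eta0 _ C0) => V oV V0 dV.
by apply: h; exists V.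
Qed.

(** From c^n (1 + n (1 - c)) <= 1, taken at an exponent with n (1 - c) >= 1. *)
Lemma epow_small (R : realType) (c : R) : 0 <= c -> c < 1 ->
  exists k, epow k c <= 2^-1.
Proof.
move=> c0 c1; pose x := 1 - c; have x0 : 0 < x by rewrite subr_gt0.
have bern n : c ^+ n * (1 + n%:R * x) <= 1.
  elim: n => [|n IHn]; first by rewrite expr0; lra.
  apply: le_trans IHn; rewrite exprSr -mulrA; apply: ler_wpM2l; first exact: exprn_ge0.
  have : 0 <= n.+1%:R * (x * x) by rewrite mulr_ge0 ?ler0n // mulr_ge0 // ltW.
  have -> : c = 1 - x by rewrite /x; lra.
  by rewrite -[n.+1]addn1 natrD; lra.
pose k := Num.truncn x^-1; exists k; rewrite /epow.
have h := bern (k.+1).*2.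
have hx : 1 <= (k.+1).*2%:R * x.
  rewrite -ler_pdivrMr // mul1r; apply: le_trans (ltW (truncnS_gt _)) _.
  by rewrite ler_nat -addnn leq_addr.
have c2 : 0 <= c ^+ (k.+1).*2 by exact: exprn_ge0.
have := ler_wpM2l c2 hx; rewrite mulr1; lra.
Qed.

Unset Implicit Arguments.

(* X <> 0 is required: the zero space has no functional of norm 1, hence no
   slices, and would satisfy the conclusion vacuously. *)
Theorem theorem3p3 (R : realType) (epsilon : R) (epsilon_gt0 : 0 < epsilon) :
  exists X : completeNormedModType R,
    [/\ exists x : X, x != 0,
        CPCP X
      & forall (f : dual X) (alpha : R),
          dual_unit_sphere X f -> 0 < alpha ->
          ((2 - epsilon)%:E <= diameter (slice f alpha))%E].
Proof.
(* [c] serves both as [lam] and as [M]: 2 c^2 >= 2 (1 - epsilon / 4)^2 >= 2 - epsilon for epsilon <=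
   2. The maximum with 1/2 keeps [c] positive for large [epsilon]. *)
pose c := Num.max 2^-1 (1 - epsilon / 4).
have c0 : 0 < c by rewrite lt_max invr_gt0 ltr0n.
have c1 : c < 1 by rewrite gt_max; apply/andP; split; lra.
have [k kc] := epow_small (ltW c0) c1.
exists (tree_space R k); split.
- exists (flow_vec R k [::]); apply/eqP => h.
  have : tval (flow_vec R k [::]) [::] = 0 by rewrite h.
  by move/eqP; rewrite /= /uniform expr0 oner_eq0.
- exact: tree_space_CPCP.
- move=> f alpha f1 alpha0.
  apply: le_trans (slice_diameter f1 alpha0 c0 kc (ltW c0) c1).
  rewrite lee_fin; case: (lerP epsilon 2) => e2; last first.
    by have : 0 <= 2 * c * c; [rewrite !mulr_ge0 // ltW | lra].
  have ce : 1 - epsilon / 4 <= c by rewrite le_max lexx orbT.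
  have : (1 - epsilon / 4) * (1 - epsilon / 4) <= c * c by apply: ler_pM; lra.
  have := sqr_ge0 epsilon; rewrite expr2; lra.
Qed.
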